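(* Let $\mathbb K$ be an algebraically closed field of characteristic $2$ and let $\mathfrak g=\mathfrak{gs}(2)$ be Shen's $14$-dimensional Lie algebra (defined in the context). Let $X_1^+=u_1\partial_{u_2}$, $X_1^-=u_2\partial_{u_1}$, $X_2^+=u_2v$, $X_2^-=u_1$, and $H_i=[X_i^+,X_i^-]$. 1) The multiplication table is: $[H_1,X_1^\pm]=0$, $[H_1,X_2^\pm]=X_2^\pm$, $[H_2,X_1^\pm]=X_1^\pm$, $[H_2,X_2^\pm]=0$, $[H_1,H_2]=0$, $[X_1^-,X_2^-]=u_2$, $[X_1^+,X_2^+]=u_1v$, $[X_1^\pm,X_2^\mp]=0$. The defining relations between the positive and negative root vectors corresponding to simple roots are $$\operatorname{ad}_{X_1^+}^2(X_2^+)=0,\qquad \operatorname{ad}_{X_2^+}^2(X_1^+)=0,$$ $$\operatorname{ad}_{X_2^-}^4(X_1^-)=0,\quad \operatorname{ad}_{X_1^-}^2\big(\operatorname{ad}_{X_2^-}^3(X_1^-)\big)=0,\quad \operatorname{ad}_{X_2^-}\operatorname{ad}_{X_1^-}\big(\operatorname{ad}_{X_2^-}^3(X_1^-)\big)=0,\quad \operatorname{ad}_{X_1^-}^2(X_2^-)=0 .$$ 2) (Outer derivations.) For a basis of $H^1(\mathfrak g;\mathfrak g)$ one can take the classes of the derivations $$c_{-4}=\partial_{u_1}\otimes\widehat{u_2v}+\partial_{u_2}\otimes\widehat{u_1v}+v\otimes\widehat{u_1u_2}+u_1\otimes\widehat{u_1u_2\partial_{u_2}}+u_2\otimes\widehat{u_1u_2\partial_{u_1}},$$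 $$c_{-2}^1=\partial_{u_2}\otimes\widehat{u_2}+v\otimes\widehat{u_2\partial_{u_1}}+u_1v\otimes\widehat{u_1u_2\partial_{u_1}}+u_1\partial_{u_2}\otimes\widehat{u_1u_2},$$ $$c_{-2}^2=\partial_{u_1}\otimes\widehat{u_1}+v\otimes\widehat{u_1\partial_{u_2}}+u_2v\otimes\widehat{u_1u_2\partial_{u_2}}+u_2\partial_{u_1}\otimes\widehat{u_1u_2},$$ $$c_2^1=u_2\otimes\widehat{\partial_{u_2}}+u_2v\otimes\widehat{u_1}+u_2\partial_{u_1}\otimes\widehat v+u_1u_2\otimes\widehat{u_1\partial_{u_2}}+u_1u_2\partial_{u_1}\otimes\widehat{u_1v},$$ $$c_2^2=u_1\otimes\widehat{\partial_{u_1}}+u_1v\otimes\widehat{u_2}+u_1\partial_{u_2}\otimes\widehat v+u_1u_2\otimes\widehat{u_2\partial_{u_1}}+u_1u_2\partial_{u_2}\otimes\widehat{u_2v},$$ $$c_4=u_2v\otimes\widehat{\partial_{u_1}}+u_1v\otimes\widehat{\partial_{u_2}}+u_1u_2\partial_{u_2}\otimes\widehat{u_1}+u_1u_2\partial_{u_1}\otimes\widehat{u_2}.$$ 3) (Central extensions.) For a basis of $H^2(\mathfrak g)$ one can take the classes of the cocycles $$c_{-2}^1=\widehat{u_2}\wedge\widehat{u_1u_2\partial_{u_1}}+\widehat{u_2\partial_{u_1}}\wedge\widehat{u_1u_2},\qquad c_{-2}^2=\widehat{u_1}\wedge\widehat{u_1u_2\partial_{u_2}}+\widehat{u_1\partial_{u_2}}\wedge\widehat{u_1u_2},\qquad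 c_4=\widehat{\partial_{u_1}}\wedge\widehat{u_1}+\widehat{\partial_{u_2}}\wedge\widehat{u_2}.$$
   Context: Let $\mathcal O=\mathbb K[u_1,u_2]/(u_1^2,u_2^2)$ (the divided power algebra with shearing vector $(1,1)$), and let $\mathfrak{vect}=\mathcal O\partial_{u_1}\oplus\mathcal O\partial_{u_2}$ be the Lie algebra of its special derivations. Let $\mathcal Ov$ be the module of volume forms. On the space $L=\mathfrak{vect}\oplus\mathcal Ov\oplus\mathcal O$ define the bracket by the commutator on $\mathfrak{vect}$, the action $[D,fv]=(D(f)+f\operatorname{div}D)v$ on $\mathcal Ov$, the natural action $[D,f]=D(f)$ on $\mathcal O$, and, for $f,g\in\mathcal O$, $$[fv,gv]=0,\qquad [fv,g]=fH_g,\qquad [f,g]=H_f(g)v,\qquad\text{where } H_f=\frac{\partial f}{\partial u_1}\partial_{u_2}+\frac{\partial f}{\partial u_2}\partial_{u_1};$$ brackets with values in $\mathcal O$ are understood modulo constants. The grading is $\deg u^r\partial_{u_i}=3|r|-3$, $\deg u^rv=3|r|-2$, $\deg u^r=3|r|-4$. Set $\mathfrak{me}=L/L_{-4}$, where $L_{-4}=\mathbb K\cdot1\subset\mathcal O$, and let $\mathfrak{gs}(2)=\mathfrak{me}^{(1)}$ be its derived algebra. It has basis $u^r\partial_{u_1},u^r\partial_{u_2}$ (with $u^r\in\{1,u_1,u_2,u_1u_2\}$), $v,u_1v,u_2v$, $u_1,u_2,u_1u_2$; hats denote the dual basis, and $a\otimes\widehat b$ is the linear map $w\mapsto\widehat b(w)a$.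 $H^1(\mathfrak g;\mathfrak g)$ is the space of derivations modulo inner ones; $H^2(\mathfrak g)$ is Chevalley--Eilenberg cohomology with trivial coefficients. Subscripts of cocycles denote their degrees. *)

(* Defs.v *)
From Stdlib Require List.
From HB Require Import structures.
From mathcomp Require Import all_boot all_order all_algebra.

Set Implicit Arguments.
Unset Strict Implicit.
Unset Printing Implicit Defensive.

Import GRing.Theory.
Local Open Scope ring_scope.

Inductive lie_term (K : fieldType) (I : Type) : Type :=
| LGen of I
| LZero
| LAdd of lie_term K I & lie_term K I
| LScale of K & lie_term K I
| LBr of lie_term K I & lie_term K I.

Arguments LGen {K I} _.
Arguments LZero {K I}.

(* The congruence on terms generated by the axioms of Lie algebras over K and  *)
(* the relations R: the Lie algebra presented by R is lie_term modulo lie_eqv. *)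
Inductive lie_eqv (K : fieldType) (I : Type)
    (R : seq (lie_term K I * lie_term K I)) :
    lie_term K I -> lie_term K I -> Prop :=
| eqv_rel s t : List.In (s, t) R -> lie_eqv R s t
| eqv_refl s : lie_eqv R s s
| eqv_sym s t : lie_eqv R s t -> lie_eqv R t s
| eqv_trans s t w : lie_eqv R s t -> lie_eqv R t w -> lie_eqv R s w
| eqv_add s s' t t' :
    lie_eqv R s s' -> lie_eqv R t t' -> lie_eqv R (LAdd s t) (LAdd s' t')
| eqv_scale a s s' : lie_eqv R s s' -> lie_eqv R (LScale a s) (LScale a s')
| eqv_br s s' t t' :
    lie_eqv R s s' -> lie_eqv R t t' -> lie_eqv R (LBr s t) (LBr s' t')
| eqv_addA s t w : lie_eqv R (LAdd s (LAdd t w)) (LAdd (LAdd s t) w)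
| eqv_addC s t : lie_eqv R (LAdd s t) (LAdd t s)
| eqv_add0 s : lie_eqv R (LAdd LZero s) s
| eqv_addN s : lie_eqv R (LAdd (LScale (-1) s) s) LZero
| eqv_scaleA a b s : lie_eqv R (LScale a (LScale b s)) (LScale (a * b) s)
| eqv_scale1 s : lie_eqv R (LScale 1 s) s
| eqv_scaleDr a s t :
    lie_eqv R (LScale a (LAdd s t)) (LAdd (LScale a s) (LScale a t))
| eqv_scaleDl a b s :
    lie_eqv R (LScale (a + b) s) (LAdd (LScale a s) (LScale b s))
| eqv_brDl s t w : lie_eqv R (LBr (LAdd s t) w) (LAdd (LBr s w) (LBr t w))
| eqv_brDr s t w : lie_eqv R (LBr s (LAdd t w)) (LAdd (LBr s t) (LBr s w))
| eqv_brZl a s t : lie_eqv R (LBr (LScale a s) t) (LScale a (LBr s t))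
| eqv_brZr a s t : lie_eqv R (LBr s (LScale a t)) (LScale a (LBr s t))
| eqv_brxx s : lie_eqv R (LBr s s) LZero
| eqv_jacobi s t w :
    lie_eqv R
      (LAdd (LBr s (LBr t w)) (LAdd (LBr t (LBr w s)) (LBr w (LBr s t))))
      LZero.

Fixpoint lie_eval (K : fieldType) (I : Type) (V : lmodType K)
    (br : V -> V -> V) (x : I -> V) (t : lie_term K I) : V :=
  match t with
  | LGen i => x i
  | LZero => 0
  | LAdd s t => lie_eval br x s + lie_eval br x t
  | LScale a s => a *: lie_eval br x s
  | LBr s t => br (lie_eval br x s) (lie_eval br x t)
  end.

(* The subalgebra generated by the x i is presented by the generators I and the *)
(* relations R: s = t is a relation of the x i iff it is a consequence of R.   *)
Definition defining_relations (K : fieldType) (I : Type) (V : lmodType K)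
    (br : V -> V -> V) (x : I -> V)
    (R : seq (lie_term K I * lie_term K I)) : Prop :=
  forall s t, lie_eqv R s t <-> lie_eval br x s = lie_eval br x t.

(* The classes of c form a basis of the quotient space Z / B. *)
Definition basis_mod (K : fieldType) (V : lmodType K) (Z B : V -> Prop)
    (n : nat) (c : n.-tuple V) : Prop :=
  [/\ forall i, Z (tnth c i),
      forall a : 'I_n -> K, B (\sum_i a i *: tnth c i) -> forall i, a i = 0
    & forall z, Z z -> exists a : 'I_n -> K, B (z - \sum_i a i *: tnth c i)].

Section Cohomology.
Variables (K : fieldType) (g : vectType K) (br : g -> g -> g).

Definition derivation (D : 'End(g)) : Prop :=
  forall x y, D (br x y) = br (D x) y + br x (D y).

Definition inner_derivation (D : 'End(g)) : Prop :=
  exists a, forall x, D x = br a x.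

(* In characteristic 2 the elements of the exterior square of the dual of g are *)
(* the alternating forms, not all the antisymmetric ones.                      *)
Definition cocycle2 (w : 'Hom(g, 'Hom(g, K^o))) : Prop :=
  (forall x, w x x = 0) /\
  (forall x y z, w (br x y) z + w (br y z) x + w (br z x) y = 0).

Definition coboundary2 (w : 'Hom(g, 'Hom(g, K^o))) : Prop :=
  exists f : 'Hom(g, K^o), forall x y, w x y = - f (br x y).

Section TensorWedge.
Variables (a : g) (f h : 'Hom(g, K^o)).

Definition tens_fun (w : g) : g := (f w : K) *: a.
Fact tens_fun_linear : linear tens_fun.
Proof. by move=> k x y; rewrite /tens_fun linearP scalerDl scalerA. Qed.
HB.instance Definition _ :=
  GRing.isLinear.Build K g g _ tens_fun tens_fun_linear.

Definition wedge_fun (x y : g) : K^o := f x * h y - h x * f y.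
Fact wedge_fun_linear x : linear (wedge_fun x).
Proof.
move=> k y z; rewrite /wedge_fun.
have lin (l : 'Hom(g, K^o)) : l (k *: y + z) = k * l y + l z by exact: linearP.
rewrite !lin -[k *: _]/(k * _) mulrBr !mulrDr opprD addrACA.
by congr (_ - _ + _); exact: mulrCA.
Qed.
HB.instance Definition _ x :=
  GRing.isLinear.Build K g K^o _ (wedge_fun x) (wedge_fun_linear x).

Definition wedge_fun2 (x : g) : 'Hom(g, K^o) := linfun (wedge_fun x).
Fact wedge_fun2_linear : linear wedge_fun2.
Proof.
move=> k x y; apply/lfunP => z; rewrite !lfunE /= !lfunE /= /wedge_fun.
have lin (l : 'Hom(g, K^o)) : l (k *: x + y) = k * l x + l y by exact: linearP.
rewrite !lin lfunE -[k *: _]/(k * (f x * h z - h x * f z)).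
by rewrite mulrBr !mulrDl !mulrA opprD addrACA.
Qed.
HB.instance Definition _ :=
  GRing.isLinear.Build K g _ _ wedge_fun2 wedge_fun2_linear.

Definition tens : 'End(g) := linfun tens_fun.
Definition wedge : 'Hom(g, 'Hom(g, K^o)) := linfun wedge_fun2.

Lemma tensE w : tens w = (f w : K) *: a.
Proof. by rewrite lfunE. Qed.

Lemma wedgeE x y : wedge x y = f x * h y - h x * f y.
Proof. by rewrite lfunE /= lfunE. Qed.

End TensorWedge.
End Cohomology.

(* The monomial u^r = u_1^{r_1} u_2^{r_2}, with r_i in {0,1}, is encoded by     *)
(* the pair of booleans r; an element of K[u_1,u_2]/(u_1^2,u_2^2) is the        *)
(* family of its coefficients.                                                 *)
Notation mon := (bool * bool)%type.
Notation Oalg K := {ffun mon -> K^o}.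

Section ShenSpace.
Variable K : fieldType.
Local Notation O := (Oalg K).

Definition mono (r : mon) : O := [ffun s => (s == r)%:R].

(* Both the ordinary and the divided-power product: u^s u^t = u^(s+t) if s + t *)
(* has entries at most 1, and 0 otherwise.                                     *)
Definition mulO (f g : O) : O :=
  [ffun r : mon => \sum_(s : mon) \sum_(t : mon |
     (s.1 + t.1 == r.1)%N && (s.2 + t.2 == r.2)%N) f s * g t : K^o].

Definition dO1 (f : O) : O := [ffun r : mon => if r.1 then 0 else f (true, r.2)].
Definition dO2 (f : O) : O := [ffun r : mon => if r.2 then 0 else f (r.1, true)].

(* (D1, D2) stands for D1 \partial_{u_1} + D2 \partial_{u_2}. *)
Notation vect := (O * O)%type.

Definition actO (D : vect) (f : O) : O := mulO D.1 (dO1 f) + mulO D.2 (dO2 f).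
Definition divO (D : vect) : O := dO1 D.1 + dO2 D.2.
Definition brV (D E : vect) : vect :=
  (actO D E.1 - actO E D.1, actO D E.2 - actO E D.2).
Definition mulV (f : O) (D : vect) : vect := (mulO f D.1, mulO f D.2).
Definition hamV (f : O) : vect := (dO2 f, dO1 f).
Definition actVol (D : vect) (f : O) : O := actO D f + mulO f (divO D).

(* (D, f, g) stands for D + f v + g. *)
Definition L : vectType K := ((O * O) * O * O)%type.
Definition mkL (D : vect) (f g : O) : L := (D, f, g).
Definition vpart (x : L) : vect := x.1.1.
Definition volpart (x : L) : O := x.1.2.
Definition fpart (x : L) : O := x.2.

(* The values on Ov x vect, O x vect and O x Ov are those forced by            *)
(* antisymmetry.                                                               *)
Definition brL (x y : L) : L :=
  mkL (brV (vpart x) (vpart y) + mulV (volpart x) (hamV (fpart y))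
         - mulV (volpart y) (hamV (fpart x)))
      (actVol (vpart x) (volpart y) - actVol (vpart y) (volpart x)
         + actO (hamV (fpart x)) (fpart y))
      (actO (vpart x) (fpart y) - actO (vpart y) (fpart x)).

(* The quotient me = L / L_{-4} is realised on the representatives whose        *)
(* O-component has no constant term; modc is the reduction L -> L / L_{-4}.    *)
Definition modc (x : L) : L :=
  mkL (vpart x) (volpart x)
      [ffun r => if r == (false, false) then 0 else fpart x r].

Definition br_me (x y : L) : L := modc (brL x y).

Fact modc_linear : linear modc.
Proof.
move=> k x y; congr (_, _, _); apply/ffunP => r; rewrite !ffunE.
by case: ifP => _ //; rewrite scaler0 addr0.
Qed.
HB.instance Definition _ := GRing.isLinear.Build K L L _ modc modc_linear.

Definition me : {vspace L} := limg (linfun modc).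

Definition gs2 : {vspace L} :=
  <<[seq br_me x y | x <- vbasis me, y <- vbasis me]>>%VS.

Definition gs : vectType K := subvs_of gs2.
Definition br (x y : gs) : gs := vsproj gs2 (br_me (vsval x) (vsval y)).

(* degree x k states that x is homogeneous of degree k (any k if x = 0). *)
Definition degree (x : L) (k : int) : Prop :=
  forall r : mon, let n : int := (r.1 + r.2)%N%:Z in
  [/\ (vpart x).1 r != 0 \/ (vpart x).2 r != 0 -> k = 3 * n - 3,
      volpart x r != 0 -> k = 3 * n - 2
    & fpart x r != 0 -> k = 3 * n - 4].

Definition degree_End (D : 'End(gs)) (d : int) : Prop :=
  forall (x : gs) (k : int),
    degree (vsval x) k -> degree (vsval (D x)) (k + d).

(* The ground field K is placed in degree 0. *)
Definition degree_form (w : 'Hom(gs, 'Hom(gs, K^o))) (d : int) : Prop :=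
  forall (x y : gs) (j k : int), degree (vsval x) j -> degree (vsval y) k ->
    w x y != 0 -> j + k + d = 0.

Local Notation m1 := (mono (false, false)).
Local Notation mu1 := (mono (true, false)).
Local Notation mu2 := (mono (false, true)).
Local Notation mu12 := (mono (true, true)).

Definition inD1 (f : O) : gs := vsproj gs2 (mkL (f, 0) 0 0).
Definition inD2 (f : O) : gs := vsproj gs2 (mkL (0, f) 0 0).
Definition inVol (f : O) : gs := vsproj gs2 (mkL 0 f 0).
Definition inO (f : O) : gs := vsproj gs2 (mkL 0 0 f).

Definition e_d1 := inD1 m1.
Definition e_u1d1 := inD1 mu1.
Definition e_u2d1 := inD1 mu2.
Definition e_u12d1 := inD1 mu12.
Definition e_d2 := inD2 m1.
Definition e_u1d2 := inD2 mu1.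
Definition e_u2d2 := inD2 mu2.
Definition e_u12d2 := inD2 mu12.
Definition e_v := inVol m1.
Definition e_u1v := inVol mu1.
Definition e_u2v := inVol mu2.
Definition e_u1 := inO mu1.
Definition e_u2 := inO mu2.
Definition e_u12 := inO mu12.

Definition gs_basis : 14.-tuple gs :=
  [tuple e_d1; e_u1d1; e_u2d1; e_u12d1; e_d2; e_u1d2; e_u2d2; e_u12d2;
         e_v; e_u1v; e_u2v; e_u1; e_u2; e_u12].

(* For b in gs_basis, hat b is the corresponding element of the dual basis. *)
Definition hat (b : gs) : 'Hom(gs, K^o) :=
  linfun (coord gs_basis (inord (index b gs_basis)) : gs -> K^o).

End ShenSpace.

Arguments br {K} x y.
Arguments hat {K} b.
Arguments e_d1 {K}.
Arguments e_u1d1 {K}.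
Arguments e_u2d1 {K}.
Arguments e_u12d1 {K}.
Arguments e_d2 {K}.
Arguments e_u1d2 {K}.
Arguments e_u2d2 {K}.
Arguments e_u12d2 {K}.
Arguments e_v {K}.
Arguments e_u1v {K}.
Arguments e_u2v {K}.
Arguments e_u1 {K}.
Arguments e_u2 {K}.
Arguments e_u12 {K}.

Section Relations.
Variables (K : fieldType) (I : Type).
Local Notation T := (lie_term K I).

Definition LAd (n : nat) (s t : T) : T := iter n (LBr s) t.

Definition rel_pos (x1 x2 : T) : seq (T * T) :=
  [:: (LAd 2 x1 x2, LZero); (LAd 2 x2 x1, LZero)].

Definition rel_neg (x1 x2 : T) : seq (T * T) :=
  [:: (LAd 4 x2 x1, LZero);
      (LAd 2 x1 (LAd 3 x2 x1), LZero);
      (LBr x2 (LBr x1 (LAd 3 x2 x1)), LZero);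
      (LAd 2 x1 x2, LZero)].

(* The entries of the multiplication table that are relations; the values of   *)
(* [X_1^-,X_2^-] and [X_1^+,X_2^+] only name new elements.                      *)
Definition rel_mixed (x1p x1m x2p x2m : T) : seq (T * T) :=
  let h1 := LBr x1p x1m in let h2 := LBr x2p x2m in
  [:: (LBr h1 x1p, LZero); (LBr h1 x1m, LZero);
      (LBr h1 x2p, x2p);   (LBr h1 x2m, x2m);
      (LBr h2 x1p, x1p);   (LBr h2 x1m, x1m);
      (LBr h2 x2p, LZero); (LBr h2 x2m, LZero);
      (LBr h1 h2, LZero);
      (LBr x1p x2m, LZero); (LBr x1m x2p, LZero)].

End Relations.

Variant simple_root := alpha1 | alpha2.
Variant chevalley_gen := GX1p | GX1m | GX2p | GX2m.

Section Generators.
Variable K : fieldType.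

Definition X1p : gs K := e_u1d2.
Definition X1m : gs K := e_u2d1.
Definition X2p : gs K := e_u2v.
Definition X2m : gs K := e_u1.
Definition H1 : gs K := br X1p X1m.
Definition H2 : gs K := br X2p X2m.

Definition Xp (i : simple_root) : gs K :=
  match i with alpha1 => X1p | alpha2 => X2p end.
Definition Xm (i : simple_root) : gs K :=
  match i with alpha1 => X1m | alpha2 => X2m end.
Definition Xall (i : chevalley_gen) : gs K :=
  match i with GX1p => X1p | GX1m => X1m | GX2p => X2p | GX2m => X2m end.

Definition rels_pos : seq (lie_term K simple_root * lie_term K simple_root) :=
  rel_pos (LGen alpha1) (LGen alpha2).
Definition rels_neg : seq (lie_term K simple_root * lie_term K simple_root) :=
  rel_neg (LGen alpha1) (LGen alpha2).
Definition rels_all :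
    seq (lie_term K chevalley_gen * lie_term K chevalley_gen) :=
  rel_mixed (LGen GX1p) (LGen GX1m) (LGen GX2p) (LGen GX2m)
    ++ rel_pos (LGen GX1p) (LGen GX2p) ++ rel_neg (LGen GX1m) (LGen GX2m).

Definition ad (n : nat) (x y : gs K) : gs K := iter n (br x) y.

End Generators.

Arguments X1p {K}.
Arguments X1m {K}.
Arguments X2p {K}.
Arguments X2m {K}.
Arguments H1 {K}.
Arguments H2 {K}.

Section Cocycles.
Variable K : fieldType.
Local Notation "a ⊗ b" := (tens a (hat b)) (at level 45).
Local Notation "a ∧ b" := (wedge (hat a) (hat b)) (at level 45).

Definition der_m4 : 'End(gs K) :=
  e_d1 ⊗ e_u2v + e_d2 ⊗ e_u1v + e_v ⊗ e_u12 + e_u1 ⊗ e_u12d2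
    + e_u2 ⊗ e_u12d1.
Definition der_m2_1 : 'End(gs K) :=
  e_d2 ⊗ e_u2 + e_v ⊗ e_u2d1 + e_u1v ⊗ e_u12d1 + e_u1d2 ⊗ e_u12.
Definition der_m2_2 : 'End(gs K) :=
  e_d1 ⊗ e_u1 + e_v ⊗ e_u1d2 + e_u2v ⊗ e_u12d2 + e_u2d1 ⊗ e_u12.
Definition der_2_1 : 'End(gs K) :=
  e_u2 ⊗ e_d2 + e_u2v ⊗ e_u1 + e_u2d1 ⊗ e_v + e_u12 ⊗ e_u1d2
    + e_u12d1 ⊗ e_u1v.
Definition der_2_2 : 'End(gs K) :=
  e_u1 ⊗ e_d1 + e_u1v ⊗ e_u2 + e_u1d2 ⊗ e_v + e_u12 ⊗ e_u2d1
    + e_u12d2 ⊗ e_u2v.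
Definition der_4 : 'End(gs K) :=
  e_u2v ⊗ e_d1 + e_u1v ⊗ e_d2 + e_u12d2 ⊗ e_u1 + e_u12d1 ⊗ e_u2.

Definition coc_m2_1 : 'Hom(gs K, 'Hom(gs K, K^o)) :=
  e_u2 ∧ e_u12d1 + e_u2d1 ∧ e_u12.
Definition coc_m2_2 : 'Hom(gs K, 'Hom(gs K, K^o)) :=
  e_u1 ∧ e_u12d2 + e_u1d2 ∧ e_u12.
Definition coc_4 : 'Hom(gs K, 'Hom(gs K, K^o)) :=
  e_d1 ∧ e_u1 + e_d2 ∧ e_u2.

End Cocycles.

(* Main.v *)
(* All structure constants of gs(2) in its monomial basis lie in F_2.            *)
(* A derivation is a 14 x 14 array of unknowns solving a homogeneous linear      *)
(* system over F_2, and so is a 2-cocycle. Computing an echelon form of the      *)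
(* system shows that its solutions are spanned by the arrays of the listed       *)
(* classes and of the inner derivations (of the coboundaries). Each listed array *)
(* has a nonzero cell where all the other spanning arrays vanish, hence the      *)
(* independence of the classes.                                                  *)
(* As for the presentations, modulo the relations the span of finitely many      *)
(* iterated brackets of the generators is stable under bracketing with the       *)
(* generators, so it is the whole presented algebra; these brackets evaluate to  *)
(* distinct basis vectors of gs(2), so no further relation can hold.             *)

Require Import Defs.
From Stdlib Require Import Setoid Morphisms.
From mathcomp Require Import all_boot all_order all_algebra.
From mathcomp Require Import ring.

Set Implicit Arguments.
Unset Strict Implicit.
Unset Printing Implicit Defensive.

Import GRing.Theory.
Local Open Scope ring_scope.

(** * Linear systems over F_2 *)

(** In characteristic 2 signs disappear and the bracket is commutative, so each assertion becomes a
    finite computation with Booleans whose result holds over every field K of characteristic 2.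

    For the cohomology, a derivation (or a bilinear form) is a vector of 196 cells in K. The Leibniz
    rule (or the cocycle identity) annihilates it by rows over F_2, and [spansP] turns an
    elimination over F_2 into a formula for each cell in terms of finitely many pivot cells. By
    [der_spans] and [coc_spans], derivations are combinations of 6 listed and 14 inner arrays, and
    cocycles of 3 listed and 14 coboundary arrays. The tests [is_der] and [is_coc] show that the
    listed maps are derivations and cocycles; [der_private] and [coc_private] give independence
    modulo inner derivations and coboundaries. [der_basis] and [coc_basis] assemble this.

    For the relations, [presentation] says that evaluation is injective on the presented algebra as
    soon as some terms span it and have independent values. Spanning is checked in [pos_closed],
    [neg_closed] and [all_closed]. The positive, negative and full sets of generators generate
    subalgebras of dimension 3, 6 and 11.

    All this is done for an abstract algebra with the given structure constants. [coordL_br]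
    computes those of the bracket on L, while [gs2_coordL] and [monoL_gs2] identify the derived
    algebra with the span of the 14 monomials. *)

Lemma natr_addb (K : fieldType) (b c : bool) : 2%N \in [pchar K] ->
  (b (+) c)%:R = b%:R + c%:R :> K.
Proof.
by move=> charK; case: b c => [] []; rewrite ?addr0 ?add0r // addrr_pchar2.
Qed.

Lemma natr_andb (K : fieldType) (b c : bool) : (b && c)%:R = b%:R * c%:R :> K.
Proof. by case: b; rewrite ?mul1r ?mul0r. Qed.

Fixpoint addv (r s : seq bool) : seq bool :=
  match r, s with
  | a :: r', b :: s' => (a (+) b) :: addv r' s'
  | [::], _ => s
  | _, [::] => r
  end.

(* The entry of index i of an echelon system is, if any, the tail of a row whose *)
(* first nonzero coefficient is in column i.                                     *)
Fixpoint insert_row (E : seq (option (seq bool))) (r : seq bool) :=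
  match E, r with
  | o :: E', b :: r' =>
      if b then
        match o with
        | Some p => o :: insert_row E' (addv p r')
        | None => Some r' :: E'
        end
      else o :: insert_row E' r'
  | _, _ => E
  end.

Definition echelon (n : nat) (rows : seq (seq bool)) :=
  foldl insert_row (nseq n None) rows.

(** Tests membership of [r] in the F_2-row space of [E] by clearing leading entries; a leading 1 in
    a column without pivot refutes membership. *)
Fixpoint reduces_to0 (E : seq (option (seq bool))) (r : seq bool) : bool :=
  match E, r with
  | o :: E', b :: r' =>
      if b then if o is Some p then reduces_to0 E' (addv p r') else false
      else reduces_to0 E' r'
  | _, _ => ~~ has id r
  end.

Section LinearSystem.
Variable K : fieldType.
Hypothesis charK : 2%N \in [pchar K].

Fixpoint dot (r : seq bool) (x : seq K) : K :=
  match r, x with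
  | b :: r', a :: x' => b%:R * a + dot r' x'
  | _, _ => 0
  end.

Fixpoint solves (E : seq (option (seq bool))) (x : seq K) : Prop :=
  match E, x with
  | o :: E', a :: x' => (if o is Some p then a + dot p x' = 0 else True) /\ solves E' x'
  | _, _ => True
  end.

Lemma dot_addv r s x : dot (addv r s) x = dot r x + dot s x.
Proof.
elim: r s x => [|a r IHr] [|b s] [|c x] /=; rewrite ?addr0 ?add0r //.
by rewrite natr_addb // IHr; ring.
Qed.

Lemma dot_foldr (b : nat -> bool) (g : nat -> seq bool) l r x :
  dot (foldr (fun s r => if b s then addv (g s) r else r) r l) x =
  \sum_(s <- l) dot (g s) x * (b s)%:R + dot r x.
Proof.
elim: l => [|s l IHl] /=; first by rewrite big_nil add0r.
rewrite big_cons; case: (b s); last by rewrite mulr0 add0r.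
by rewrite dot_addv IHl mulr1 addrA.
Qed.

Lemma solves_insert E r x : solves E x -> dot r x = 0 -> solves (insert_row E r) x.
Proof.
elim: E r x => [|o E IHE] [|b r] [|a x] //=; first by case: b o => [] [].
move=> [ho hE]; case: b => /=; last by rewrite mul0r add0r; split=> //; exact: IHE.
rewrite mul1r => hr; case: o ho => [p|] ho /=; split=> //; apply: IHE => //.
(* Adding [a + a = 0] makes the claim the sum of the equations of the pivot row and of the new
   row. *)
by rewrite dot_addv; apply: (addrI (a + a)); rewrite addrACA ho hr !addr0 addrr_pchar2.
Qed.

Lemma dot_reduces E r x : solves E x -> reduces_to0 E r -> dot r x = 0.
Proof.
have dot0 s y : ~~ has id s -> dot s y = 0.
  elim: s y => [|b s IHs] [|a y] //=; case: b => //= hs.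
  by rewrite mul0r add0r IHs.
elim: E r x => [|o E IHE] [|b r] [|a x]; try by move=> _ /dot0.
  by [].
move=> [ho hE] /=; case: b => /=; last by rewrite mul0r add0r; exact: IHE.
case: o ho => // p ha /(IHE _ _ hE); rewrite dot_addv mul1r => hr.
have -> : a + dot r x = (a + dot p x) + (dot p x + dot r x).
  by rewrite addrA -[a + _ + _]addrA addrr_pchar2 // addr0.
by rewrite ha hr addr0.
Qed.

(** Elimination only stores F_2-sums of the given rows, so the stored rows, and whatever they reduce
    to 0, annihilate the common zeros of [rows] over K. *)
Lemma dot_echelon n rows r x :
  {in rows, forall s, dot s x = 0} -> reduces_to0 (echelon n rows) r -> dot r x = 0.
Proof.
move=> hrows; apply: dot_reduces; rewrite /echelon.
have : solves (nseq n None) x by elim: n x {hrows} => [|n IHn] [|a x] //=.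
elim: rows hrows (nseq n None) => //= s rows IH hrows E hE; apply: IH.
  by move=> r' hr'; apply: hrows; rewrite inE hr' orbT.
by apply: solves_insert => //; apply: hrows; rewrite mem_head.
Qed.

End LinearSystem.

Definition cells := [seq (i, j) | i <- iota 0 14, j <- iota 0 14].
Definition row_of (f : nat -> nat -> bool) : seq bool := [seq f p.1 p.2 | p <- cells].
Definition cell_row (q : nat * nat) := row_of (fun i j => (i == q.1) && (j == q.2)).

Arguments cells : simpl never.
Arguments row_of f : simpl never.
Arguments cell_row q : simpl never.

Section Arrays.
Variable K : fieldType.
Hypothesis charK : 2%N \in [pchar K].
Variable X : nat -> nat -> K.

Definition pairing (f : nat -> nat -> bool) : K :=
  \sum_(i < 14) \sum_(j < 14) (f i j)%:R * X i j.

Definition vec_of : seq K := [seq X p.1 p.2 | p <- cells].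

Arguments vec_of : simpl never.

Lemma dot_row_of f : dot (row_of f) vec_of = pairing f.
Proof.
transitivity (\sum_(p <- cells) (f p.1 p.2)%:R * X p.1 p.2).
  rewrite /row_of /vec_of; elim: cells => [|p s IHs] /=; first by rewrite big_nil.
  by rewrite big_cons IHs.
rewrite /cells big_allpairs /pairing.
have E (g : nat -> K) : \sum_(i <- iota 0 14) g i = \sum_(i < 14) g i.
  by rewrite -[iota 0 14]/(index_iota 0 14) big_mkord.
by rewrite E; apply: eq_bigr => i _; rewrite E.
Qed.

Lemma pairingD f g : pairing (fun i j => f i j (+) g i j) = pairing f + pairing g.
Proof.
rewrite /pairing -big_split; apply: eq_bigr => i _; rewrite -big_split.
by apply: eq_bigr => j _; rewrite natr_addb // mulrDl.
Qed.

Lemma pairing_row a f : (a < 14)%N ->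
  pairing (fun i j => (i == a) && f j) = \sum_(j < 14) (f j)%:R * X a j.
Proof.
move=> ha; rewrite /pairing (bigD1 (Ordinal ha)) //= eqxx [X in _ + X]big1 ?addr0 //.
move=> i ia; rewrite big1 // => j _; rewrite (_ : (i == a :> nat) = false) ?mul0r //.
exact: negbTE.
Qed.

Lemma pairing_col a f : (a < 14)%N ->
  pairing (fun i j => (j == a) && f i) = \sum_(i < 14) (f i)%:R * X i a.
Proof.
move=> ha; apply: eq_bigr => i _.
rewrite (bigD1 (Ordinal ha)) //= eqxx big1 ?addr0 //.
move=> j ja; rewrite (_ : (j == a :> nat) = false) ?mul0r //; exact: negbTE.
Qed.

Lemma sum_unit a (F : nat -> K) : (a < 14)%N ->
  \sum_(j < 14) (j == a :> nat)%:R * F j = F a.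
Proof.
move=> ha; rewrite (bigD1 (Ordinal ha)) //= eqxx mul1r big1 ?addr0 //.
move=> j ja; rewrite (_ : (j == a :> nat) = false) ?mul0r //; exact: negbTE.
Qed.

Lemma dot_cell_row q : q \in cells -> dot (cell_row q) vec_of = X q.1 q.2.
Proof.
move=> /allpairsP[[i j] [+ + ->]]; rewrite !mem_iota => hi hj.
by rewrite dot_row_of pairing_row // sum_unit.
Qed.

(* The entries of piv are the coordinates in the basis dual to S: among the      *)
(* arrays of S, only S s is nonzero in the s-th cell of piv.                     *)
Definition spans rows n (S : nat -> nat -> nat -> bool) (piv : seq (nat * nat)) :=
  let E := echelon 196 rows in
  all (fun p => reduces_to0 E
    (foldr (fun s r => if S s p.1 p.2 then addv (cell_row (nth (0, 0)%N piv s)) r else r)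
       (cell_row p) (iota 0 n))) cells.

(** The row certified for a cell says that this cell plus the pivot cells of the arrays containing
    it sum to 0. In characteristic 2 this expresses the cell by the pivots. *)
Lemma spansP rows n S piv i j :
  all (fun q => q \in cells) piv ->
  {in rows, forall r, dot r vec_of = 0} -> spans rows n S piv ->
  (i < 14)%N -> (j < 14)%N ->
  X i j = \sum_(s < n) X (nth (0, 0)%N piv s).1 (nth (0, 0)%N piv s).2 * (S s i j)%:R.
Proof.
move=> hpiv hrows /allP hS hi hj.
have mem14 k : (k < 14)%N -> k \in iota 0 14 by rewrite mem_iota.
have hij : (i, j) \in cells.
  by rewrite /cells; apply/allpairsP; exists (i, j); split=> //; exact: mem14.
have := dot_echelon charK hrows (hS _ hij).
(* Beyond the end of [piv] the default (0, 0) is read, which is a cell as well. *)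
have piv_cell s : nth (0, 0)%N piv s \in cells.
  by have [hs|hs] := ltnP s (size piv); rewrite ?(nth_default _ hs) // (allP hpiv) ?mem_nth.
rewrite (dot_foldr charK (fun s => S s i j) (fun s => cell_row (nth (0, 0)%N piv s))).
under eq_bigr do rewrite dot_cell_row //.
rewrite dot_cell_row // (_ : iota 0 n = index_iota 0 n); last by rewrite /index_iota subn0.
by rewrite big_mkord => h; apply/esym/eqP; rewrite -subr_eq0 oppr_pchar2 // h.
Qed.

End Arrays.

(** * Arrays of structure constants, derivations and cocycles *)

(* The triple (i, j, k) stands for the term e_k of [e_i, e_j], where e_0, ...,   *)
(* e_13 is gs_basis and e_14 = u_1 u_2 v.                                        *)
Definition structure_constants : seq (nat * nat * nat) := [::
  (0,1,0); (0,3,2); (0,5,4); (0,7,6); (0,9,8); (0,13,12); (0,14,10);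
  (1,2,2); (1,5,5); (1,7,7); (1,8,8); (1,10,10); (1,11,11); (1,13,13);
  (2,4,0); (2,5,1); (2,5,6); (2,6,2); (2,7,3); (2,9,10); (2,11,12);
  (3,4,1); (3,5,7); (3,6,3); (3,8,10); (3,11,13);
  (4,6,4); (4,7,5); (4,10,8); (4,13,11); (4,14,9);
  (5,6,5); (5,10,9); (5,12,11);
  (6,8,8); (6,9,9); (6,12,12); (6,13,13);
  (7,8,9); (7,12,13);
  (8,11,4); (8,12,0); (8,13,1); (8,13,6);
  (9,11,5); (9,12,1); (9,13,7);
  (10,11,6); (10,12,2); (10,13,3);
  (11,12,8); (11,13,9); (11,14,7);
  (12,13,10); (12,14,3)]%N.

(** The table lists each unordered pair in one order only; the xor with the transposed match makes
    the bracket alternating over F_2. *)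
Definition br_coef (a b k : nat) : bool :=
  foldr (fun t c => if t.2 == k
    then ((t.1.1 == a) && (t.1.2 == b)) (+) ((t.1.2 == a) && (t.1.1 == b)) (+) c
    else c) false structure_constants.

Section Tables.
Local Open Scope nat_scope.

(* The pair (k, i) stands for e_k tensored with the hat of e_i. *)
Definition der_cells : seq (seq (nat * nat)) := [::
  [:: (0, 10); (4, 9); (8, 13); (11, 7); (12, 3)];
  [:: (4, 12); (8, 2); (9, 3); (5, 13)];
  [:: (0, 11); (8, 5); (10, 7); (2, 13)];
  [:: (12, 4); (10, 11); (2, 8); (13, 5); (3, 9)];
  [:: (11, 0); (9, 12); (5, 8); (13, 2); (7, 10)];
  [:: (10, 0); (9, 4); (7, 11); (3, 12)]].

(* The pair (i, j) stands for the wedge of the hats of e_i and e_j. *)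
Definition coc_cells : seq (seq (nat * nat)) := [::
  [:: (12, 3); (2, 13)]; [:: (11, 7); (5, 13)]; [:: (0, 11); (4, 12)]].

Definition der_array (s k i : nat) : bool := (k, i) \in nth [::] der_cells s.
(** In characteristic 2 a wedge is the sum of the tensor and of its transpose. *)
Definition sym_cells (l : seq (nat * nat)) := l ++ [seq (p.2, p.1) | p <- l].
Definition coc_array (s i j : nat) : bool := (i, j) \in sym_cells (nth [::] coc_cells s).

(* The arrays after the first 6 are those of the inner derivations ad e_m. *)
Definition der_arrays (s k i : nat) : bool :=
  if s < 6 then der_array s k i else br_coef (s - 6) i k.
(* The arrays after the first 3 are those of the coboundaries of the hats of e_m. *)
Definition coc_arrays (s i j : nat) : bool :=
  if s < 3 then coc_array s i j else br_coef i j (s - 3).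

Definition der_pivots : seq (nat * nat) := [::
  (0, 10); (4, 12); (0, 11); (2, 8); (5, 8); (3, 12);
  (0, 1); (0, 0); (0, 4); (1, 4); (0, 2); (1, 2); (3, 3); (3, 2);
  (0, 12); (1, 12); (2, 12); (4, 8); (0, 8); (1, 8)].
Definition coc_pivots : seq (nat * nat) := [::
  (2, 13); (5, 13); (0, 11);
  (0, 1); (3, 4); (0, 3); (2, 7); (0, 5); (1, 5); (0, 7); (1, 7);
  (0, 9); (5, 10); (1, 10); (1, 11); (0, 13); (1, 13)].

(* In the array of a derivation D, the cell (k, l) holds the coordinate of D e_l *)
(* on e_k.                                                                       *)
Definition der_row (i j k : nat) : seq bool := row_of (fun k' l =>
  (k' == k) && br_coef i j l (+) (l == i) && br_coef k' j k
     (+) (l == j) && br_coef i k' k).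

(* u_1, u_2 and u_1 u_2, of indices 11, 12 and 13, generate gs(2), so the Leibniz *)
(* rule for brackets with them is enough.                                        *)
Definition der_index : seq (nat * nat * nat) :=
  [seq (q, k) | q <- [seq (i, j) | i <- [:: 11; 12; 13], j <- iota 0 14], k <- iota 0 14].
Definition der_rows : seq (seq bool) :=
  [seq der_row t.1.1 t.1.2 t.2 | t <- der_index].

(** The cocycle identity on [e_i], [e_j], [e_k], where cell (a, b) holds w(e_a, e_b). *)
Definition coc_row (i j k : nat) : seq bool := row_of (fun a b =>
  (b == k) && br_coef i j a (+) (b == i) && br_coef j k a (+) (b == j) && br_coef k i a).
Definition sym_row (p : nat * nat) : seq bool := row_of (fun a b =>
  (a == p.1) && (b == p.2) (+) (a == p.2) && (b == p.1)).
Definition coc_index : seq (nat * nat * nat) :=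
  [seq t <- [seq (q, k) | q <- cells, k <- iota 0 14] | (t.1.1 < t.1.2) && (t.1.2 < t.2)].
(** The first two blocks say that the form is alternating. Then the cocycle sum is alternating in
    its three arguments, so increasing triples give all the identities. *)
Definition coc_rows : seq (seq bool) :=
  [seq cell_row (i, i) | i <- iota 0 14] ++ [seq sym_row p | p <- cells & p.1 < p.2] ++
  [seq coc_row t.1.1 t.1.2 t.2 | t <- coc_index].

End Tables.

(** The upper bound on derivations: 588 Leibniz equations reduce the 196 unknowns to 20 pivots, one
    for each listed or inner array. *)
Lemma der_spans : spans der_rows 20 der_arrays der_pivots.
Proof. by vm_compute. Qed.
Lemma coc_spans : spans coc_rows 17 coc_arrays coc_pivots.
Proof. by vm_compute. Qed.

(** * Boolean certificates for the listed maps and for the Jacobi identity *)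

Definition xor_sum (T : Type) (l : seq T) (P F : T -> bool) : bool :=
  foldr (fun p c => if P p then F p (+) c else c) false l.

Definition cells14 (l : seq (nat * nat)) := all (fun p => (p.1 < 14) && (p.2 < 14))%N l.

Definition triples : seq (nat * nat * nat) :=
  [seq (q, k) | q <- cells, k <- iota 0 14].
Arguments triples : simpl never.

(** The Leibniz rule on basis vectors, coordinate by coordinate, for the sum of the tensors listed
    in [l]. The last term has its bracket reversed, which changes nothing in characteristic 2. *)
Definition is_der (l : seq (nat * nat)) : bool :=
  all (fun t => let i := t.1.1 in let j := t.1.2 in let k := t.2 in
    xor_sum l (fun p => p.1 == k) (fun p => br_coef i j p.2) ==
    xor_sum l (fun p => p.2 == i) (fun p => br_coef p.1 j k)
      (+) xor_sum l (fun p => p.2 == j) (fun p => br_coef p.1 i k))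
   triples.

Lemma triple_mem i j k : (i < 14)%N -> (j < 14)%N -> (k < 14)%N ->
  (i, j, k) \in triples.
Proof.
move=> hi hj hk; apply/allpairsP; exists ((i, j), k); split=> //.
  by apply/allpairsP; exists (i, j); split=> //; rewrite mem_iota.
by rewrite mem_iota.
Qed.

Lemma der_index_lt : all (fun t => [&& t.1.1 < 14, t.1.2 < 14 & t.2 < 14])%N der_index.
Proof. by vm_compute. Qed.

Lemma coc_index_lt : all (fun t => [&& t.1.1 < 14, t.1.2 < 14 & t.2 < 14])%N coc_index.
Proof. by vm_compute. Qed.

Lemma cells_lt : all (fun p => (p.1 < 14) && (p.2 < 14))%N cells.
Proof. by vm_compute. Qed.

Definition is_coc (l : seq (nat * nat)) : bool :=
  all (fun t => let i := t.1.1 in let j := t.1.2 in let k := t.2 in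
    ~~ (xor_sum (sym_cells l) (fun p => p.2 == k) (fun p => br_coef i j p.1)
      (+) xor_sum (sym_cells l) (fun p => p.2 == i) (fun p => br_coef j k p.1)
      (+) xor_sum (sym_cells l) (fun p => p.2 == j) (fun p => br_coef k i p.1)))
   triples.

Lemma coc_cells_ok :
  all (fun l => [&& cells14 l, uniq (sym_cells l) & is_coc l]) coc_cells.
Proof. by vm_compute. Qed.

(** At the pivot cell of a listed cocycle the other listed ones and all coboundaries vanish, so
    reading a relation there isolates one coefficient. *)
Lemma coc_private : all (fun s => let q := nth (0, 0)%N coc_pivots s in
  [&& (q.1 < 14)%N, (q.2 < 14)%N,
      all (fun t => coc_array t q.1 q.2 == (t == s)) (iota 0 3)
    & all (fun m => ~~ br_coef q.1 q.2 m) (iota 0 14)]) (iota 0 3).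
Proof. by vm_compute. Qed.

Definition prods (i j : nat) : seq nat := [seq k <- iota 0 14 | br_coef i j k].
Definition prodl (A B : seq nat) : seq nat := flatten [seq prods i j | i <- A, j <- B].
Definition even_mults (A : seq nat) : bool := all (fun k => ~~ odd (count_mem k A)) A.
Arguments prods i j : simpl never.
Arguments prodl A B : simpl never.

(* A table, so that each product is evaluated only once by vm_compute. *)
Definition prod_table := [seq [seq prods i j | j <- iota 0 14] | i <- iota 0 14].

Definition table_prodl (T : seq (seq (seq nat))) (A B : seq nat) : seq nat :=
  flatten [seq nth [::] (nth [::] T i) j | i <- A, j <- B].
Local Notation lt14 := (all (fun i => (i < 14)%N)).

Lemma prods_lt i j : lt14 (prods i j).
Proof. by apply/allP => k; rewrite mem_filter mem_iota => /andP[]. Qed.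

Lemma prodl_lt A B : lt14 (prodl A B).
Proof.
apply/allP => k /flattenP[s /allpairsP[p [_ _ ->]]]; exact: (allP (prods_lt _ _)).
Qed.

Lemma table_prodlE A B : lt14 A -> lt14 B -> table_prodl prod_table A B = prodl A B.
Proof.
move=> /allP hA /allP hB; congr flatten; apply/eq_in_allpairs => i j /hA hi /hB hj.
have it k : (k < 14)%N -> (k < size (iota 0 14))%N by rewrite size_iota.
rewrite /prod_table (nth_map 0%N _ _ (it _ hi)) (nth_map 0%N _ _ (it _ hj)).
by rewrite (nth_iota _ _ hi) (nth_iota _ _ hj).
Qed.

(** A sum of basis vectors is kept as a list of indices, and it vanishes when each index occurs an
    even number of times. *)
Lemma jacobi_even : let P := table_prodl prod_table in
  all (fun t => let i := [:: t.1.1] in let j := [:: t.1.2] in let k := [:: t.2] in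
    even_mults (P i (P j k) ++ P j (P k i) ++ P k (P i j))) triples.
Proof. by vm_compute. Qed.

(* The indices of the basis vectors whose sum is the value of a term without     *)
(* scalars; only the parities of their multiplicities matter.                    *)
Fixpoint mults (K : fieldType) (I : Type) (f : I -> nat) (t : lie_term K I) :=
  match t with
  | LGen i => if (f i < 14)%N then Some [:: f i] else None
  | LZero => Some [::]
  | LAdd s t => if (mults f s, mults f t) is (Some A, Some B) then Some (A ++ B) else None
  | LBr s t => if (mults f s, mults f t) is (Some A, Some B) then Some (prodl A B) else None
  | LScale _ _ => None
  end.

Definition eq_mults (K : fieldType) (I : Type) (f : I -> nat)
    (p : lie_term K I * lie_term K I) : bool :=
  if (mults f p.1, mults f p.2) is (Some A, Some B) then even_mults (A ++ B) else false.

Lemma der_cells_ok : all (fun l => [&& cells14 l, uniq l & is_der l]) der_cells.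
Proof. by vm_compute. Qed.

(** The analogue of [coc_private], with inner derivations in place of coboundaries. *)
Lemma der_private : all (fun s => let q := nth (0, 0)%N der_pivots s in
  [&& (q.1 < 14)%N, (q.2 < 14)%N,
      all (fun t => der_array t q.1 q.2 == (t == s)) (iota 0 6)
    & all (fun m => ~~ br_coef m q.2 q.1) (iota 0 14)]) (iota 0 6).
Proof. by vm_compute. Qed.

(** * Presentations of Lie algebras by generators and relations *)

Section LieTerms.
Variables (K : fieldType) (I : Type) (R : seq (lie_term K I * lie_term K I)).
Local Notation T := (lie_term K I).
Local Notation "s ≡ t" := (lie_eqv R s t) (at level 70).

#[local] Instance lie_eqv_equivalence : Equivalence (lie_eqv R).
Proof.
split; [exact: eqv_refl | exact: eqv_sym | exact: eqv_trans].
Qed.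
#[local] Instance LAdd_proper : Proper (lie_eqv R ==> lie_eqv R ==> lie_eqv R) (@LAdd K I).
Proof. by move=> s s' hs t t' ht; exact: eqv_add. Qed.
#[local] Instance LBr_proper : Proper (lie_eqv R ==> lie_eqv R ==> lie_eqv R) (@LBr K I).
Proof. by move=> s s' hs t t' ht; exact: eqv_br. Qed.
#[local] Instance LScale_proper a : Proper (lie_eqv R ==> lie_eqv R) (LScale a).
Proof. by move=> s s' hs; exact: eqv_scale. Qed.

#[local] Hint Resolve eqv_refl : core.

Lemma eqv_addr0 s : LAdd s LZero ≡ s.
Proof. by rewrite -> eqv_addC, eqv_add0. Qed.

Lemma eqv_addCA s t u : LAdd s (LAdd t u) ≡ LAdd t (LAdd s u).
Proof. by rewrite -> eqv_addA, (eqv_addC R s t), <- eqv_addA. Qed.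

Lemma eqv_addI u s t : LAdd u s ≡ LAdd u t -> s ≡ t.
Proof.
move=> h; rewrite <- (eqv_add0 R s), <- (eqv_add0 R t), <- (eqv_addN R u).
by rewrite <- !eqv_addA, h.
Qed.

Lemma eqv_scale0 s : LScale 0 s ≡ LZero.
Proof.
apply: (@eqv_addI (LScale 0 s)); rewrite <- eqv_scaleDl; rewrite addr0.
by rewrite -> eqv_addr0.
Qed.

Lemma eqv_scale_zero a : LScale a (@LZero K I) ≡ LZero.
Proof.
apply: (@eqv_addI (LScale a LZero)); rewrite <- eqv_scaleDr.
by rewrite -> eqv_add0, eqv_addr0.
Qed.

Lemma eqv_br0l s : LBr LZero s ≡ LZero.
Proof.
apply: (@eqv_addI (LBr LZero s)); rewrite <- eqv_brDl.
by rewrite -> eqv_add0, eqv_addr0.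
Qed.

Lemma eqv_br0r s : LBr s LZero ≡ LZero.
Proof.
apply: (@eqv_addI (LBr s LZero)); rewrite <- eqv_brDr.
by rewrite -> eqv_add0, eqv_addr0.
Qed.

Fixpoint lincomb (c : nat -> K) (b : seq T) : T :=
  if b is t :: b' then LAdd (LScale (c 0%N) t) (lincomb (c \o succn) b') else LZero.

Lemma lincombD c d b :
  lincomb (fun i => c i + d i) b ≡ LAdd (lincomb c b) (lincomb d b).
Proof.
elim: b c d => [|t b IHb] c d /=; first by rewrite -> eqv_add0.
rewrite -> (IHb (c \o succn) (d \o succn)), eqv_scaleDl.
rewrite <- !eqv_addA; apply: eqv_add; first reflexivity.
exact: eqv_addCA.
Qed.

Lemma lincombZ a c b : lincomb (fun i => a * c i) b ≡ LScale a (lincomb c b).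
Proof.
elim: b c => [|t b IHb] c /=; first by rewrite -> eqv_scale_zero.
by rewrite -> (IHb (c \o succn)), eqv_scaleDr, eqv_scaleA.
Qed.

Definition inspan b t := exists c, t ≡ lincomb c b.

Lemma inspan_eqv b s t : s ≡ t -> inspan b t -> inspan b s.
Proof. by move=> h [c hc]; exists c; rewrite -> h. Qed.

Lemma inspan0 b : inspan b LZero.
Proof.
exists (fun=> 0); elim: b => [|t b IHb] /=; first reflexivity.
by rewrite <- IHb, eqv_scale0, eqv_add0.
Qed.

Lemma inspanD b s t : inspan b s -> inspan b t -> inspan b (LAdd s t).
Proof.
move=> [c hc] [d hd]; exists (fun i => c i + d i).
by rewrite -> lincombD, hc, hd.
Qed.

Lemma inspanZ b a t : inspan b t -> inspan b (LScale a t).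
Proof. by move=> [c hc]; exists (fun i => a * c i); rewrite -> lincombZ, hc. Qed.

Lemma inspan_mem b t : List.In t b -> inspan b t.
Proof.
elim: b => //= s b IHb [->|/IHb[c hc]].
  have [c hc] := inspan0 b; exists (fun i => if i is j.+1 then c j else 1) => /=.
  by rewrite -> eqv_scale1, <- hc, eqv_addr0.
exists (fun i => if i is j.+1 then c j else 0) => /=.
by rewrite -> eqv_scale0, <- hc, eqv_add0.
Qed.

Lemma inspan_br b t : (forall s, List.In s b -> inspan b (LBr t s)) ->
  forall s, inspan b s -> inspan b (LBr t s).
Proof.
move=> h s [c hc]; apply: (@inspan_eqv _ _ (LBr t (lincomb c b))); first by rewrite -> hc.
suff sub d : (forall u, List.In u d -> List.In u b) -> inspan b (LBr t (lincomb c d)).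
  exact: sub.
elim: d c {hc} => [|u d IHd] c /= hd.
  by apply: (inspan_eqv (eqv_br0r _)); exact: inspan0.
apply: (inspan_eqv (eqv_brDr _ _ _ _)); apply: inspanD; last first.
  by apply: IHd => v hv; apply: hd; right.
by apply: (inspan_eqv (eqv_brZr _ _ _ _)); apply/inspanZ/h/hd; left.
Qed.

Hypothesis charK : 2%N \in [pchar K].

Lemma eqv_addxx s : LAdd s s ≡ LZero.
Proof.
have e2 : 1 + 1 = 0 :> K by exact: addrr_pchar2.
by rewrite <- (eqv_scale1 R s), <- eqv_scaleDl; rewrite e2; exact: eqv_scale0.
Qed.

Lemma eqv_add_eq0 s t : LAdd s t ≡ LZero <-> s ≡ t.
Proof.
split=> [h|->]; last exact: eqv_addxx.
by apply: (@eqv_addI t); rewrite -> eqv_addxx, eqv_addC.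
Qed.

(** Polarisation of [s + t, s + t] = 0. *)
Lemma eqv_brC s t : LBr s t ≡ LBr t s.
Proof.
have := eqv_brxx R (LAdd s t).
rewrite -> eqv_brDl, !eqv_brDr, !eqv_brxx, eqv_add0, eqv_addr0.
by move/eqv_add_eq0.
Qed.

Lemma eqv_br_br s t w : LBr (LBr s t) w ≡ LAdd (LBr s (LBr t w)) (LBr t (LBr s w)).
Proof.
rewrite -> (eqv_brC (LBr s t) w); apply/eqv_add_eq0.
rewrite <- (eqv_jacobi R s t w).
by rewrite -> (eqv_brC w s), (eqv_addC _ (LBr w _)), <- eqv_addA.
Qed.

Lemma eqv_br_brr s t w : LBr s (LBr t w) ≡ LAdd (LBr (LBr s t) w) (LBr t (LBr s w)).
Proof.
by rewrite -> eqv_br_br, <- eqv_addA, eqv_addxx, eqv_addr0.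
Qed.

Definition pos_basis (x y : T) : seq T := [:: x; y; LBr x y].

(** The target [b] is left free because the lemma serves both for the positive part alone and inside
    the larger span of [all_closed]. *)
Lemma pos_closed x y b :
  LAd 2 x y ≡ LZero -> LAd 2 y x ≡ LZero ->
  (forall s, List.In s (pos_basis x y) -> inspan b s) ->
  forall s, List.In s (pos_basis x y) -> inspan b (LBr x s) /\ inspan b (LBr y s).
Proof.
rewrite /LAd /= => hxy hyx hb.
have in3 : inspan b (LBr x y) by apply: hb; right; right; left.
move=> s [<-|[<-|[<-|//]]]; split.
- by apply: (inspan_eqv (eqv_brxx _ _)); exact: inspan0.
- by apply: (inspan_eqv (eqv_brC _ _)).
- by [].
- by apply: (inspan_eqv (eqv_brxx _ _)); exact: inspan0.
- by apply: (inspan_eqv hxy); exact: inspan0.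
- apply: (@inspan_eqv _ _ LZero); last exact: inspan0.
  by rewrite -> (eqv_brC x y).
Qed.

(** At x = X_1^- and y = X_2^- these evaluate to u_2∂_1, u_1, u_2, v, ∂_2, ∂_1. *)
Definition neg_basis (x y : T) : seq T :=
  [:: x; y; LBr y x; LAd 2 y x; LAd 3 y x; LBr x (LAd 3 y x)].

(** With u = [y, x], Jacobi gives [x, [y, u]] = [u, u] + [y, [x, u]], and [x, u] = 0 by the
    relation. This extra consequence completes the multiplication by x in [neg_closed]. *)
Lemma neg_br2 x y : LAd 2 x y ≡ LZero -> LBr x (LAd 2 y x) ≡ LZero.
Proof.
rewrite /LAd /= => hxy; have hyx : LBr x (LBr y x) ≡ LZero by rewrite -> (eqv_brC y x).
by rewrite -> eqv_br_brr, (eqv_brC x y), eqv_brxx, hyx, eqv_br0r, eqv_add0.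
Qed.

Lemma neg_closed x y b :
  LAd 4 y x ≡ LZero -> LAd 2 x (LAd 3 y x) ≡ LZero ->
  LBr y (LBr x (LAd 3 y x)) ≡ LZero -> LAd 2 x y ≡ LZero ->
  (forall s, List.In s (neg_basis x y) -> inspan b s) ->
  forall s, List.In s (neg_basis x y) -> inspan b (LBr x s) /\ inspan b (LBr y s).
Proof.
move=> h1 h2 h3 h4 hb; have h5 := neg_br2 h4.
move: h1 h2 h3 h4 h5 hb; rewrite /LAd /neg_basis /LAd /= => h1 h2 h3 h4 h5 hb.
have zero s : s ≡ LZero -> inspan b s by move=> h; apply: (inspan_eqv h); exact: inspan0.
move=> s [<-|[<-|[<-|[<-|[<-|[<-|//]]]]]]; split.
- exact/zero/eqv_brxx.
- by apply: hb; tauto.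
- by apply: (inspan_eqv (eqv_brC _ _)); apply: hb; tauto.
- exact/zero/eqv_brxx.
- by apply: zero; rewrite -> (eqv_brC y x).
- by apply: hb; tauto.
- exact: zero.
- by apply: hb; tauto.
- by apply: hb; tauto.
- exact: zero.
- exact: zero.
- exact: zero.
Qed.

(* The first entry is H1 + H2 rather than H1, as H1 + H2 evaluates to the basis  *)
(* vector u_1 d/du_1 of gs(2) and H1 does not evaluate to a basis vector.        *)
Definition all_basis (xp xm yp ym : T) : seq T :=
  LAdd (LBr xp xm) (LBr yp ym) :: LBr yp ym :: (pos_basis xp yp ++ neg_basis xm ym).

(** A triangular decomposition: the two signed parts are closed by themselves, [h1] and [h2] act
    diagonally, and a bracket of opposite signs is pushed inward by Jacobi until it meets an [h] or
    a vanishing [X_i^+, X_j^-]. *)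
Lemma all_closed xp xm yp ym (b := all_basis xp xm yp ym) :
  (forall s t,
     List.In (s, t) (rel_mixed xp xm yp ym ++ rel_pos xp yp ++ rel_neg xm ym) ->
     s ≡ t) ->
  forall s, List.In s b ->
    [/\ inspan b (LBr xp s), inspan b (LBr xm s), inspan b (LBr yp s)
      & inspan b (LBr ym s)].
Proof.
set h1 := LBr xp xm; set h2 := LBr yp ym.
rewrite /rel_mixed -/h1 -/h2 => hrel.
have h1xp : LBr h1 xp ≡ LZero by apply: hrel; rewrite /=; tauto.
have h1xm : LBr h1 xm ≡ LZero by apply: hrel; rewrite /=; tauto.
have h1yp : LBr h1 yp ≡ yp by apply: hrel; rewrite /=; tauto.
have h1ym : LBr h1 ym ≡ ym by apply: hrel; rewrite /=; tauto.
have h2xp : LBr h2 xp ≡ xp by apply: hrel; rewrite /=; tauto.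
have h2xm : LBr h2 xm ≡ xm by apply: hrel; rewrite /=; tauto.
have h2yp : LBr h2 yp ≡ LZero by apply: hrel; rewrite /=; tauto.
have h2ym : LBr h2 ym ≡ LZero by apply: hrel; rewrite /=; tauto.
have xpym : LBr xp ym ≡ LZero by apply: hrel; rewrite /=; tauto.
have xmyp : LBr xm yp ≡ LZero by apply: hrel; rewrite /=; tauto.
have p1 : LAd 2 xp yp ≡ LZero by apply: hrel; rewrite /=; tauto.
have p2 : LAd 2 yp xp ≡ LZero by apply: hrel; rewrite /=; tauto.
have n1 : LAd 4 ym xm ≡ LZero by apply: hrel; rewrite /=; tauto.
have n2 : LAd 2 xm (LAd 3 ym xm) ≡ LZero by apply: hrel; rewrite /=; tauto.
have n3 : LBr ym (LBr xm (LAd 3 ym xm)) ≡ LZero by apply: hrel; rewrite /=; tauto.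
have n4 : LAd 2 xm ym ≡ LZero by apply: hrel; rewrite /=; tauto.
have n5 := neg_br2 n4.
have zero s : s ≡ LZero -> inspan b s by move=> h; apply: (inspan_eqv h); exact: inspan0.
have mem s : List.In s b -> inspan b s by exact: inspan_mem.
have hpos s : List.In s (pos_basis xp yp) -> inspan b s.
  by move=> hs; apply: mem; move: hs; rewrite /=; tauto.
have hneg s : List.In s (neg_basis xm ym) -> inspan b s.
  by move=> hs; apply: mem; move: hs; rewrite /=; tauto.
have pos := pos_closed p1 p2 hpos.
have neg := neg_closed n1 n2 n3 n4 hneg.
have bxp : inspan b xp by apply: mem; rewrite /=; tauto.
have byp : inspan b yp by apply: mem; rewrite /=; tauto.
have bxm : inspan b xm by apply: mem; rewrite /=; tauto.
have bym : inspan b ym by apply: mem; rewrite /=; tauto.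
have bh2 : inspan b h2 by apply: mem; rewrite /=; tauto.
have bh1 : inspan b h1.
  have h : h1 ≡ LAdd (LAdd h1 h2) h2 by rewrite <- eqv_addA, eqv_addxx, eqv_addr0.
  by apply: (inspan_eqv h); apply: inspanD => //; apply: mem; left.
move: n1 n2 n3 n5 neg hneg; rewrite /neg_basis /LAd /=.
set u := LBr ym xm; set v := LBr ym u; set d := LBr ym v; set w := LBr xm d.
move=> n1 n2 n3 n5 neg hneg.
(* Weights add modulo 2 along brackets: [xm] and [ym] have weights 0, 1 for [h1] and 1, 0 for
   [h2]. *)
have h1u : LBr h1 u ≡ u.
  by rewrite /u; rewrite -> (eqv_br_brr h1 ym xm), h1ym, h1xm, eqv_br0r, eqv_addr0.
have h1v : LBr h1 v ≡ LZero.
  by rewrite /v; rewrite -> (eqv_br_brr h1 ym u), h1ym, h1u, eqv_addxx.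
have h1d : LBr h1 d ≡ d.
  by rewrite /d; rewrite -> (eqv_br_brr h1 ym v), h1ym, h1v, eqv_br0r, eqv_addr0.
have h2u : LBr h2 u ≡ u.
  by rewrite /u; rewrite -> (eqv_br_brr h2 ym xm), h2ym, h2xm, eqv_br0l, eqv_add0.
have h2v : LBr h2 v ≡ v.
  by rewrite /v; rewrite -> (eqv_br_brr h2 ym u), h2ym, h2u, eqv_br0l, eqv_add0.
have xpu : LBr xp u ≡ ym.
  rewrite /u; rewrite -> (eqv_br_brr xp ym xm), xpym, eqv_br0l, eqv_add0.
  by rewrite -> (eqv_brC ym); exact: h1ym.
have xpv : LBr xp v ≡ LZero.
  by rewrite /v; rewrite -> (eqv_br_brr xp ym u), xpym, eqv_br0l, xpu, eqv_brxx, eqv_add0.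
have xpd : LBr xp d ≡ LZero.
  by rewrite /d; rewrite -> (eqv_br_brr xp ym v), xpym, eqv_br0l, xpv, eqv_br0r, eqv_add0.
have xpw : LBr xp w ≡ d.
  by rewrite /w; rewrite -> (eqv_br_brr xp xm d), xpd, eqv_br0r, eqv_addr0; exact: h1d.
have ypxm : LBr yp xm ≡ LZero by rewrite -> eqv_brC.
have ypu : LBr yp u ≡ xm.
  by rewrite /u; rewrite -> (eqv_br_brr yp ym xm), ypxm, eqv_br0r, eqv_addr0; exact: h2xm.
have ypv : LBr yp v ≡ LZero.
  (* Both Jacobi terms, [h2, u] and [ym, xm], equal [u] and cancel. *)
  rewrite /v; rewrite -> (eqv_br_brr yp ym u), ypu; rewrite -/h2.
  by rewrite -> h2u; exact: eqv_addxx.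
have ypd : LBr yp d ≡ v.
  by rewrite /d; rewrite -> (eqv_br_brr yp ym v), ypv, eqv_br0r, eqv_addr0.
have ypw : LBr yp w ≡ LZero.
  by rewrite /w; rewrite -> (eqv_br_brr yp xm d), ypxm, eqv_br0l, ypd, eqv_add0.
have bu : inspan b u by apply: hneg; tauto.
have bv : inspan b v by apply: hneg; tauto.
have bd : inspan b d by apply: hneg; tauto.
have xmz : LBr xm (LBr xp yp) ≡ yp.
  by rewrite -> eqv_br_brr, xmyp, eqv_br0r, eqv_addr0, (eqv_brC xm); exact: h1yp.
have ymz : LBr ym (LBr xp yp) ≡ xp.
  rewrite -> eqv_br_brr, (eqv_brC ym xp), xpym, eqv_br0l, eqv_add0, (eqv_brC ym yp).
  by rewrite -> (eqv_brC xp).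
have br_h1 t : inspan b (LBr h1 t) -> inspan b (LBr t h1).
  by apply: inspan_eqv; exact: eqv_brC.
have br_h2 t : inspan b (LBr h2 t) -> inspan b (LBr t h2).
  by apply: inspan_eqv; exact: eqv_brC.
have bxph1 : inspan b (LBr xp h1) by exact/br_h1/zero.
have bxmh1 : inspan b (LBr xm h1) by exact/br_h1/zero.
have byph1 : inspan b (LBr yp h1) by apply/br_h1/(inspan_eqv h1yp).
have bymh1 : inspan b (LBr ym h1) by apply/br_h1/(inspan_eqv h1ym).
have bxph2 : inspan b (LBr xp h2) by apply/br_h2/(inspan_eqv h2xp).
have bxmh2 : inspan b (LBr xm h2) by apply/br_h2/(inspan_eqv h2xm).
have byph2 : inspan b (LBr yp h2) by exact/br_h2/zero.
have bymh2 : inspan b (LBr ym h2) by exact/br_h2/zero.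
have brD t s s' : inspan b (LBr t s) -> inspan b (LBr t s') -> inspan b (LBr t (LAdd s s')).
  by move=> hs hs'; apply: (inspan_eqv (eqv_brDr _ _ _ _)); exact: inspanD.
have cases s : List.In s b -> s = LAdd h1 h2 \/ s = h2 \/
    List.In s (pos_basis xp yp) \/ List.In s (neg_basis xm ym) by rewrite /=; intuition.
move=> s /cases[->|[->|[hs|hs]]].
- by split; apply: brD.
- by split.
- have [? ?] := pos _ hs; split=> //; case: hs => [<-|[<-|[<-|//]]].
  + by apply: (inspan_eqv (eqv_brC _ _)).
  + exact: zero.
  + exact: (inspan_eqv xmz).
  + by apply: zero; rewrite -> eqv_brC.
  + by apply: (inspan_eqv (eqv_brC _ _)).
  + exact: (inspan_eqv ymz).
have [? ?] := neg _ hs; split=> //; case: hs => [<-|[<-|[<-|[<-|[<-|[<-|//]]]]]] //.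
- exact: zero.
- exact: (inspan_eqv xpu).
- exact: zero.
- exact: zero.
- exact: (inspan_eqv xpw).
- exact: zero.
- exact: (inspan_eqv ypu).
- exact: zero.
- exact: (inspan_eqv ypd).
- exact: zero.
Qed.

(** * Evaluation of terms and the criterion for a presentation *)

Variables (V : lmodType K) (br : V -> V -> V) (x : I -> V).
Hypothesis brDl : forall k u v w, br (k *: u + v) w = k *: br u w + br v w.
Hypothesis brC : forall u v, br u v = br v u.
Hypothesis brxx : forall u, br u u = 0.
Hypothesis jacobi : forall u v w, br u (br v w) + br v (br w u) + br w (br u v) = 0.
Local Notation eval := (lie_eval br x).

Lemma lie_eqv_sound : (forall s t, List.In (s, t) R -> eval s = eval t) ->
  forall s t, s ≡ t -> eval s = eval t.
Proof.
move=> hR.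
have brDr k u v w : br w (k *: u + v) = k *: br w u + br w v.
  by rewrite ![br w _]brC brDl.
have brD u v w : br (u + v) w = br u w + br v w by rewrite -[u]scale1r brDl !scale1r.
have br0 w : br 0 w = 0.
  by have := brDl (-1) 0 0 w; rewrite !scaleN1r oppr0 addr0 addNr.
have brZ k u w : br (k *: u) w = k *: br u w.
  by rewrite -[k *: u]addr0 brDl br0 addr0.
move=> s t; elim=> {s t} /=.
- exact: hR.
- by [].
- by move=> s t _ ->.
- by move=> s t w _ -> _ ->.
- by move=> s s' t t' _ -> _ ->.
- by move=> a s s' _ ->.
- by move=> s s' t t' _ -> _ ->.
- by move=> *; rewrite addrA.
- by move=> *; rewrite addrC.
- by move=> *; rewrite add0r.
- by move=> *; rewrite scaleN1r addNr.
- by move=> *; rewrite scalerA.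
- by move=> *; rewrite scale1r.
- by move=> *; rewrite scalerDr.
- by move=> *; rewrite scalerDl.
- by move=> *; rewrite brD.
- by move=> s t w; rewrite brC brD (brC (eval t)) (brC (eval w)).
- by move=> *; rewrite brZ.
- by move=> a s t; rewrite brC brZ (brC (eval t)).
- by move=> *; rewrite brxx.
- by move=> *; rewrite addrA jacobi.
Qed.

Lemma eval_lincomb c b :
  eval (lincomb c b) = \sum_(i < size b) c i *: eval (nth LZero b i).
Proof.
elim: b c => [|t b IHb] c /=; first by rewrite big_ord0.
by rewrite big_ord_recl /= IHb.
Qed.

(** The span of [b] contains the generators and is stable under them, so it is the whole presented
    algebra; independent values then force two terms with equal values to have equal
    coefficients. *)
Lemma presentation (b : seq T) :
  (forall s t, List.In (s, t) R -> eval s = eval t) ->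
  (forall i, inspan b (LGen i)) ->
  (forall i t, List.In t b -> inspan b (LBr (LGen i) t)) ->
  (forall c : nat -> K, \sum_(i < size b) c i *: eval (nth LZero b i) = 0 ->
     forall i, (i < size b)%N -> c i = 0) ->
  defining_relations br x R.
Proof.
move=> hR hgen hbr hfree.
(* Lying in the span and preserving it under bracketing are proved together: a bracket [s, t] lies
   in the span because s preserves it, and preserves it by Jacobi. *)
have span_t t : inspan b t /\ forall s, inspan b s -> inspan b (LBr t s).
  elim: t => [i||s [hs bs] t [ht bt]|a t [ht bt]|s [hs bs] t [ht bt]].
  - by split; [exact: hgen | exact: (inspan_br (hbr i))].
  - split; first exact: inspan0.
    by move=> s _; apply: (inspan_eqv (eqv_br0l _)); exact: inspan0.
  - split; first exact: inspanD.
    move=> w hw; apply: (inspan_eqv (eqv_brDl _ _ _ _)).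
    by apply: inspanD; [exact: bs|exact: bt].
  - split; first exact: inspanZ.
    by move=> w hw; apply: (inspan_eqv (eqv_brZl _ _ _ _)); apply/inspanZ/bt.
  - split; first exact: bs.
    move=> w hw; apply: (inspan_eqv (eqv_br_br _ _ _)); apply: inspanD.
      by apply/bs/bt.
    by apply/bt/bs.
move=> s t; split; first exact: lie_eqv_sound.
have [[c hc] _] := span_t s; have [[d hd] _] := span_t t.
rewrite (lie_eqv_sound hR hc) (lie_eqv_sound hR hd) => hcd.
rewrite -> hc, hd.
have h i : (i < size b)%N -> c i = d i.
  move=> hi; apply/eqP; rewrite -subr_eq0; apply/eqP; move: i hi.
  apply: (hfree (fun i => c i - d i)).
  under eq_bigr do rewrite scalerBl.
  by rewrite sumrB -!eval_lincomb hcd subrr.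
rewrite (_ : lincomb c b = lincomb d b); first reflexivity.
elim: b c d h {hgen hbr hfree span_t hc hd hcd} => //= u b IHb c d h.
by rewrite h // (IHb (c \o succn) (d \o succn)) // => i hi; rewrite /= h.
Qed.

End LieTerms.

Lemma eq_defining_relations (K : fieldType) (I : Type) (V : lmodType K)
    (br : V -> V -> V) (x y : I -> V) R :
  x =1 y -> defining_relations br x R -> defining_relations br y R.
Proof.
move=> xy hx s t; have E u : lie_eval br y u = lie_eval br x u.
  by elim: u => //= [u -> v ->|a u ->|u -> v ->].
by rewrite !E.
Qed.

(** * Lie algebras with the structure constants of gs(2) *)

Section StructureConstants.
Variable K : fieldType.
Hypothesis charK : 2%N \in [pchar K].
Variables (g : vectType K) (br : g -> g -> g) (e : nat -> g).
Variables (crd : g -> nat -> K) (hat_e : nat -> 'Hom(g, K^o)).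
Hypothesis brDl : forall k x y z, br (k *: x + y) z = k *: br x z + br y z.
Hypothesis brC : forall x y, br x y = br y x.
Hypothesis crdP : forall k x y i, crd (k *: x + y) i = k * crd x i + crd y i.
Hypothesis crd_e : forall a i, (a < 14)%N -> crd (e a) i = (i == a)%:R.
Hypothesis sum_crd : forall x, x = \sum_(i < 14) crd x i *: e i.
Hypothesis crd_br_e : forall i j k, (i < 14)%N -> (j < 14)%N ->
  crd (br (e i) (e j)) k = (br_coef i j k)%:R.
Hypothesis hat_eE : forall i x, (i < 14)%N -> hat_e i x = crd x i.
Implicit Types x y z : g.

Lemma crd0 i : crd 0 i = 0.
Proof. by have := crdP (-1) 0 0 i; rewrite scaleN1r oppr0 addr0 mulN1r addNr. Qed.

Lemma crdD x y i : crd (x + y) i = crd x i + crd y i.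
Proof. by rewrite -[x]scale1r crdP mul1r scale1r. Qed.

Lemma crdZ k x i : crd (k *: x) i = k * crd x i.
Proof. by rewrite -[_ *: _]addr0 crdP crd0 addr0. Qed.

Lemma crd_sum n (F : 'I_n -> g) i : crd (\sum_j F j) i = \sum_j crd (F j) i.
Proof.
by apply: (big_morph (crd^~ i)) => [x y|]; rewrite ?crdD ?crd0.
Qed.

Lemma eq_crd x y : (forall i, (i < 14)%N -> crd x i = crd y i) -> x = y.
Proof.
by move=> h; rewrite [x]sum_crd [y]sum_crd; apply: eq_bigr => i _; rewrite h.
Qed.

Lemma ind_e (P : g -> Prop) :
  P 0 -> (forall k x y, P x -> P y -> P (k *: x + y)) ->
  (forall i, (i < 14)%N -> P (e i)) -> forall x, P x.
Proof.
move=> P0 PD Pe x; rewrite [x]sum_crd.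
apply: big_ind => // [u v Pu Pv | i _]; first by rewrite -[u]scale1r; exact: PD.
by rewrite -[_ *: _]addr0; apply: PD => //; exact: Pe.
Qed.

Lemma natr_xor_sum (T : Type) (l : seq T) (P F : T -> bool) :
  (xor_sum l P F)%:R = \sum_(p <- l | P p) (F p)%:R :> K.
Proof.
elim: l => [|p l IHl] /=; first by rewrite big_nil.
by rewrite big_cons; case: ifP => // _; rewrite natr_addb // IHl.
Qed.

Lemma br0l y : br 0 y = 0.
Proof. by have := brDl (-1) 0 0 y; rewrite !scaleN1r oppr0 addr0 addNr. Qed.

Lemma crd_br_el x j k : (j < 14)%N ->
  crd (br x (e j)) k = \sum_(m < 14) crd x m * (br_coef m j k)%:R.
Proof.
move=> hj; rewrite {1}[x]sum_crd.
apply: (big_ind2 (fun v c => crd (br v (e j)) k = c)) => [|u a v b hu hv|m _].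
  by rewrite br0l crd0.
  by rewrite -[u]scale1r brDl // crdP mul1r hu hv.
by rewrite -[_ *: _]addr0 brDl // br0l addr0 crdZ crd_br_e.
Qed.

Lemma br0r y : br y 0 = 0.
Proof. by rewrite brC br0l. Qed.

Lemma brDr k x y z : br z (k *: x + y) = k *: br z x + br z y.
Proof. by rewrite ![br z _]brC brDl. Qed.

Definition der_map (l : seq (nat * nat)) : 'End(g) :=
  \sum_(p <- l) tens (e p.1) (hat_e p.2).

Lemma crd_der_map l x k : cells14 l ->
  crd (der_map l x) k = \sum_(p <- l | p.1 == k) crd x p.2.
Proof.
rewrite /der_map; elim: l => [|p l IHl] /=; first by rewrite !big_nil lfunE crd0.
move=> /andP[/andP[h1 h2] hl]; rewrite !big_cons add_lfunE crdD IHl // tensE crdZ.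
rewrite hat_eE // crd_e // [k == _]eq_sym; case: eqP => _ ; first by rewrite mulr1.
by rewrite mulr0 add0r.
Qed.

Lemma der_map_e l i : cells14 l -> (i < 14)%N ->
  der_map l (e i) = \sum_(p <- l | p.2 == i) e p.1.
Proof.
rewrite /der_map; elim: l => [|p l IHl] /=; first by rewrite !big_nil lfunE.
move=> /andP[/andP[h1 h2] hl] hi; rewrite !big_cons add_lfunE IHl // tensE.
by rewrite hat_eE // crd_e //; case: eqP => _; rewrite ?scale1r // scale0r add0r.
Qed.

Lemma crd_der_map_e l k i : cells14 l -> uniq l -> (i < 14)%N ->
  crd (der_map l (e i)) k = ((k, i) \in l)%:R.
Proof.
move=> hl ul hi; rewrite crd_der_map //.
under eq_bigr do rewrite crd_e //.
elim: l ul {hl} => [|p l IHl] /=; first by rewrite big_nil.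
case/andP=> pl ul; rewrite big_cons inE IHl // [(k, i) == p]eq_sym.
have -> : (p == (k, i)) = (p.1 == k) && (p.2 == i) by [].
case: (p.1 =P k) => [pk|_] //=; case: (p.2 =P i) => [pi|_] //=; last by rewrite add0r.
by rewrite -pk -pi -surjective_pairing (negbTE pl) addr0.
Qed.

Lemma crd_br_sum (l : seq (nat * nat)) (P : pred (nat * nat)) j k :
  cells14 l -> (j < 14)%N ->
  crd (br (\sum_(p <- l | P p) e p.1) (e j)) k = \sum_(p <- l | P p) (br_coef p.1 j k)%:R.
Proof.
move=> hl hj; elim: l hl => [|p l IHl] /=; first by rewrite !big_nil br0l crd0.
move=> /andP[/andP[h1 h2] hl]; rewrite !big_cons; case: (P p); rewrite ?IHl //.
by rewrite -[e p.1]scale1r brDl // crdP mul1r crd_br_e // IHl.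
Qed.

Lemma der_map_derivation l : cells14 l -> is_der l -> derivation br (der_map l).
Proof.
move=> hl /allP hder x y; move: x; apply: ind_e => // [|k u v hu hv|i hi].
- by rewrite br0l !linear0 !br0l addr0.
- by rewrite brDl // !(linearP (der_map l)) /= !brDl // hu hv scalerDr addrACA.
move: y; apply: ind_e => // [|k u v hu hv|j hj].
- by rewrite brC !linear0 [br (e i) 0]brC ![br _ 0]brC !br0l linear0 addr0.
- by rewrite brDr // !(linearP (der_map l)) /= !brDr // hu hv scalerDr addrACA.
apply: eq_crd => // k hk; rewrite crdD crd_der_map // !der_map_e //.
rewrite crd_br_sum // [br (e i) (\sum_(_ <- _ | _) _)]brC crd_br_sum //.
under eq_bigr do rewrite crd_br_e //.
have /eqP /(congr1 (fun b : bool => b%:R : K)) := hder _ (triple_mem hi hj hk).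
by rewrite natr_addb // !natr_xor_sum.
Qed.

Definition coc_map (l : seq (nat * nat)) : 'Hom(g, 'Hom(g, K^o)) :=
  \sum_(p <- l) wedge (hat_e p.1) (hat_e p.2).

Lemma coc_mapE l x y : cells14 l -> coc_map l x y =
  \sum_(p <- sym_cells l) crd x p.1 * crd y p.2.
Proof.
rewrite /coc_map /sym_cells big_cat big_map /= -big_split /=.
elim: l => [|p l IHl] /=; first by rewrite !big_nil !lfunE.
move=> /andP[/andP[h1 h2] hl]; rewrite !big_cons !add_lfunE IHl // wedgeE !hat_eE //.
by congr (_ + _); rewrite oppr_pchar2.
Qed.

Lemma crd_lfun (D : 'End(g)) x k :
  crd (D x) k = \sum_(l < 14) crd x l * crd (D (e l)) k.
Proof.
by rewrite {1}[x]sum_crd linear_sum crd_sum; apply: eq_bigr => l _; rewrite linearZ crdZ.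
Qed.

Lemma sum_ordD m n (F : nat -> K) :
  \sum_(s < m + n) F s = \sum_(s < m) F s + \sum_(s < n) F (m + s)%N.
Proof. exact: big_split_ord. Qed.

Lemma crd_comb (b : nat -> K) j : (j < 14)%N -> crd (\sum_(m < 14) b m *: e m) j = b j.
Proof.
move=> hj; rewrite -[RHS](sum_unit b hj) crd_sum; apply: eq_bigr => m _.
by rewrite crdZ crd_e // mulrC eq_sym.
Qed.

Lemma lform_crd (f : 'Hom(g, K^o)) x : f x = \sum_(l < 14) crd x l * f (e l).
Proof.
by rewrite {1}[x]sum_crd linear_sum; apply: eq_bigr => l _; rewrite linearZ.
Qed.

Lemma der_rows_dot (D : 'End(g)) : derivation br D ->
  {in der_rows, forall r, dot r (vec_of (fun k i => crd (D (e i)) k)) = 0}.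
Proof.
move=> hD _ /mapP[[[i j] k] /(allP der_index_lt)/and3P[/= hi hj hk] ->].
rewrite /der_row dot_row_of !pairingD // pairing_row // !pairing_col //.
have <- : crd (D (br (e i) (e j))) k = \sum_(l < 14) (br_coef i j l)%:R * crd (D (e l)) k.
  by rewrite crd_lfun; apply: eq_bigr => l _; rewrite crd_br_e.
have <- : crd (br (D (e i)) (e j)) k =
    \sum_(m < 14) (br_coef m j k)%:R * crd (D (e i)) m.
  by rewrite crd_br_el //; apply: eq_bigr => m _; rewrite mulrC.
have <- : crd (br (e i) (D (e j))) k =
    \sum_(m < 14) (br_coef i m k)%:R * crd (D (e j)) m.
  rewrite brC crd_br_el //; apply: eq_bigr => m _.
  by rewrite mulrC -!crd_br_e // brC.
(* The Leibniz rule turns the row into z + z. *)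
by rewrite hD crdD -addrA addrr_pchar2.
Qed.

Lemma der_basis (c : 6.-tuple 'End(g)) :
  (forall s, tnth c s = der_map (nth [::] der_cells s)) ->
  basis_mod (derivation br) (inner_derivation br) c.
Proof.
move=> hc.
have hcell (s : 'I_6) :=
  allP der_cells_ok _ (mem_nth [::] (ltn_ord s : s < size der_cells)%N).
have crd_c (s : 'I_6) k i : (i < 14)%N -> crd (tnth c s (e i)) k = (der_array s k i)%:R.
  by move=> hi; have /and3P[h1 h2 _] := hcell s; rewrite hc crd_der_map_e.
split=> [s|a [v hv] s|D hD].
- by have /and3P[h1 h2 h3] := hcell s; rewrite hc; exact: der_map_derivation.
(* An inner combination is read in the pivot cell of [s], where only [a s] survives. *)
- have := allP der_private s; rewrite mem_iota => /(_ (ltn_ord s)).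
  case: (nth _ _ _) => k i /and4P[hk hi /allP h6 /allP h14].
  have arr (t : 'I_6) : der_array t k i = (t == s).
    by have := h6 t; rewrite mem_iota => /(_ (ltn_ord t)) /eqP.
  have := congr1 (fun x => crd x k) (hv (e i)); rewrite crd_br_el // [RHS]big1 => [|m _].
    rewrite sum_lfunE => h; rewrite -h.
    rewrite (_ : crd _ _ = \sum_(t < 6) a t * crd (tnth c t (e i)) k).
      rewrite (bigD1 s) //= crd_c // arr eqxx mulr1 big1 ?addr0 //.
      by move=> t ts; rewrite crd_c // arr (negbTE ts) mulr0.
    by rewrite crd_sum; apply: eq_bigr => t _; rewrite scale_lfunE crdZ.
  by rewrite (negbTE (h14 m _)) ?mulr0 // mem_iota; exact: (ltn_ord m).
(* Pivot values 0 to 5 of the array of [D] are the coefficients of the classes; the other 14 are the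
   coordinates of the element whose inner derivation is the remainder. *)
pose X k i := crd (D (e i)) k.
pose al s := X (nth (0, 0)%N der_pivots s).1 (nth (0, 0)%N der_pivots s).2.
exists (fun s : 'I_6 => al s), (\sum_(m < 14) al (6 + m)%N *: e m).
apply: ind_e => [|k x y hx hy|i hi].
- by rewrite linear0 brC br0l.
- by rewrite (linearP (D - _)) /= brDr hx hy.
apply: eq_crd => k hk; rewrite crd_br_el //.
under [RHS]eq_bigr => m _ do rewrite (crd_comb (fun m => al (6 + m)%N)) //.
have := spansP (X := X) charK (S := der_arrays) (piv := der_pivots) _
  (der_rows_dot hD) der_spans hk hi.
rewrite (sum_ordD 6 14 (fun s => al s * (der_arrays s k i)%:R)) => /(_ erefl) hX.
have -> : crd ((D - \sum_(s < 6) al s *: tnth c s) (e i)) k =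
    X k i - \sum_(s < 6) al s * (der_array s k i)%:R.
  rewrite add_lfunE crdD; congr (_ + _).
  rewrite opp_lfunE -scaleN1r crdZ mulN1r sum_lfunE; congr (- _).
  by rewrite crd_sum; apply: eq_bigr => s _; rewrite scale_lfunE crdZ crd_c.
apply/eqP; rewrite subr_eq addrC hX; apply/eqP; congr (_ + _).
  by apply: eq_bigr => s _; rewrite /der_arrays ltn_ord.
by apply: eq_bigr => m _; rewrite /der_arrays ltnNge leq_addr addKn.
Qed.

Lemma lform_br (f : 'Hom(g, K^o)) i j : (i < 14)%N -> (j < 14)%N ->
  f (br (e i) (e j)) = \sum_(l < 14) (br_coef i j l)%:R * f (e l).
Proof.
by move=> hi hj; rewrite lform_crd; apply: eq_bigr => l _; rewrite crd_br_e.
Qed.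

Lemma coc_map_er l x k : cells14 l -> (k < 14)%N ->
  coc_map l x (e k) = \sum_(p <- sym_cells l | p.2 == k) crd x p.1.
Proof.
move=> hl hk; rewrite coc_mapE // [RHS]big_mkcond; apply: eq_bigr => p _.
by rewrite crd_e //; case: eqP; rewrite ?mulr1 ?mulr0.
Qed.

Lemma coc_map_e l i j : cells14 l -> uniq (sym_cells l) ->
  (i < 14)%N -> (j < 14)%N ->
  coc_map l (e i) (e j) = ((i, j) \in sym_cells l)%:R.
Proof.
move=> hl ul hi hj; rewrite coc_map_er //.
under eq_bigr do rewrite crd_e //.
elim: (sym_cells l) ul => [|p s IHs] /=; first by rewrite big_nil.
case/andP=> ps us; rewrite big_cons inE IHs // [(i, j) == p]eq_sym.
have -> : (p == (i, j)) = (p.1 == i) && (p.2 == j) by [].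
case: (p.2 =P j) => [pj|_]; rewrite ?andbF //=; case: (p.1 =P i) => [pi|_] //=.
  by rewrite -pi -pj -surjective_pairing (negbTE ps) addr0.
by rewrite add0r.
Qed.

Lemma coc_map_br l i j k : cells14 l -> (i < 14)%N -> (j < 14)%N -> (k < 14)%N ->
  coc_map l (br (e i) (e j)) (e k) =
  (xor_sum (sym_cells l) (fun p => p.2 == k) (fun p => br_coef i j p.1))%:R.
Proof.
move=> hl hi hj hk; rewrite natr_xor_sum coc_map_er //.
by apply: eq_bigr => p _; rewrite crd_br_e.
Qed.

Lemma coc_map_cocycle l : cells14 l -> is_coc l -> cocycle2 br (coc_map l).
Proof.
move=> hl /allP hcoc; split=> [x|x y z].
  rewrite coc_mapE // /sym_cells big_cat big_map /= -big_split big1 // => p _.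
  by rewrite /= mulrC addrr_pchar2.
pose w := coc_map l.
pose E x y z := w (br x y) z + w (br y z) x + w (br z x) y : K.
have Ecyc a b c : E a b c = E b c a by rewrite /E [RHS]addrC addrA.
(* Linearity reduces only the first argument to basis vectors. [P] records what is known of the
   other two, and cyclic rotations bring each argument to the front. *)
have E_ind (P : g -> g -> Prop) : (forall i y z, (i < 14)%N -> P y z -> E (e i) y z = 0) ->
    forall x y z, P y z -> E x y z = 0.
  move=> hP {}x {}y {}z hyz; move: x; apply: ind_e => [|k u v hu hv|i hi].
  - by rewrite /E br0l [br z 0]brC br0l !linear0 !lfunE !add0r.
  - rewrite -[RHS](mulr0 k) -{}[X in k * X]hu -[RHS]addr0 -hv /E.
    rewrite brDl brDr (linearP w) (linearP (w (br y z))) (linearP w) /=.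
    rewrite !add_lfunE !scale_lfunE /=.
    by rewrite -![k *: _]/(k * _); ring.
  - exact: hP.
apply: (E_ind (fun _ _ => True)) => // i {}y {}z hi _; rewrite Ecyc.
apply: (E_ind (fun _ x => x = e i)) => // j {}z _ hj ->; rewrite Ecyc.
apply: (E_ind (fun x y => x = e i /\ y = e j)) => // k _ _ hk [-> ->]; rewrite Ecyc /E /w.
have /negbTE /(congr1 (fun b : bool => b%:R : K)) := hcoc _ (triple_mem hi hj hk).
by rewrite !natr_addb // -!coc_map_br.
Qed.

Lemma alt_sym (w : 'Hom(g, 'Hom(g, K^o))) x y : (forall z, w z z = 0) -> w x y = w y x.
Proof.
move=> h; have := h (x + y); rewrite (linearD w) add_lfunE.
rewrite (linearD (w x)) (linearD (w y)) /= !h add0r addr0 => /eqP.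
by rewrite addr_eq0 oppr_pchar2 // => /eqP.
Qed.

Lemma coc_rows_dot (w : 'Hom(g, 'Hom(g, K^o))) : cocycle2 br w ->
  {in coc_rows, forall r, dot r (vec_of (fun i j => w (e i) (e j) : K)) = 0}.
Proof.
move=> [wxx hw] r; rewrite !mem_cat => /or3P[/mapP[i hi ->]|/mapP[p + ->]|/mapP[t ht ->]].
- rewrite dot_cell_row ?wxx //; exact: allpairs_f.
- rewrite mem_filter => /andP[_ /(allP cells_lt)/andP[hi hj]].
  rewrite dot_row_of pairingD // !pairing_row //.
  rewrite (sum_unit (fun b => w (e p.1) (e b))) // (sum_unit (fun b => w (e p.2) (e b))) //.
  by rewrite (alt_sym _ _ wxx) addrr_pchar2.
have /and3P[hi hj hk] := allP coc_index_lt _ ht.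
rewrite dot_row_of !pairingD // !pairing_col //.
rewrite -[RHS](hw (e t.1.1) (e t.1.2) (e t.2)).
by rewrite ![w (br _ _) _](alt_sym _ _ wxx) !lform_br //; congr (_ + _ + _);
  apply: eq_bigr => l _; rewrite (alt_sym _ _ wxx).
Qed.

Lemma coc_basis (c : 3.-tuple 'Hom(g, 'Hom(g, K^o))) :
  (forall s, tnth c s = coc_map (nth [::] coc_cells s)) ->
  basis_mod (cocycle2 br) (coboundary2 br) c.
Proof.
move=> hc.
have hcell (s : 'I_3) :=
  allP coc_cells_ok _ (mem_nth [::] (ltn_ord s : s < size coc_cells)%N).
have c_e (s : 'I_3) i j : (i < 14)%N -> (j < 14)%N ->
    tnth c s (e i) (e j) = (coc_array s i j)%:R.
  by move=> hi hj; have /and3P[h1 h2 _] := hcell s; rewrite hc coc_map_e.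
have sum_c (a : 'I_3 -> K) x y :
    (\sum_s a s *: tnth c s) x y = \sum_s a s * (tnth c s x y : K).
  by rewrite !sum_lfunE; apply: eq_bigr => s _; rewrite !scale_lfunE.
split=> [s|a [f hf] s|w hw].
- by have /and3P[h1 h2 h3] := hcell s; rewrite hc; exact: coc_map_cocycle.
- have := allP coc_private s; rewrite mem_iota => /(_ (ltn_ord s)).
  case: (nth _ _ _) => i j /and4P[hi hj /allP h3 /allP h14].
  have arr (t : 'I_3) : coc_array t i j = (t == s).
    by have := h3 t; rewrite mem_iota => /(_ (ltn_ord t)) /eqP.
  have := hf (e i) (e j); rewrite sum_c lform_br // [X in - X]big1 => [|m _].
    rewrite oppr0 => <-; rewrite (bigD1 s) //= c_e // arr eqxx mulr1 big1 ?addr0 //.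
    by move=> t ts; rewrite c_e // arr (negbTE ts) mulr0.
  by rewrite (negbTE (h14 m _)) ?mul0r // mem_iota; exact: (ltn_ord m).
pose X i j := w (e i) (e j) : K.
pose al s := X (nth (0, 0)%N coc_pivots s).1 (nth (0, 0)%N coc_pivots s).2.
(* The 14 pivots after the first 3 are the coefficients of the linear form whose coboundary is the
   remainder. *)
exists (fun s : 'I_3 => al s), (\sum_(m < 14) al (3 + m)%N *: hat_e m) => x y.
have hX i j : (i < 14)%N -> (j < 14)%N ->
    w (e i) (e j) = \sum_(s < 3) al s * (tnth c s (e i) (e j) : K)
      + (\sum_(m < 14) al (3 + m)%N *: hat_e m) (br (e i) (e j)).
  move=> hi hj.
  have := spansP (X := X) charK (S := coc_arrays) (piv := coc_pivots) _
    (coc_rows_dot hw) coc_spans hi hj.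
  rewrite (sum_ordD 3 14 (fun s => al s * (coc_arrays s i j)%:R)) => /(_ erefl) hX.
  rewrite [LHS]hX.
  congr (_ + _).
    by apply: eq_bigr => s _; rewrite c_e // /coc_arrays ltn_ord.
  rewrite sum_lfunE; apply: eq_bigr => m _.
  by rewrite scale_lfunE hat_eE // crd_br_e // /coc_arrays ltnNge leq_addr addKn.
move: x y; apply: ind_e => [y|k u v hu hv y|i hi].
- by rewrite !linear0 lfunE br0l linear0 oppr0.
- by rewrite (linearP (w - _)) add_lfunE scale_lfunE hu hv brDl linearP opprD scalerN.
apply: ind_e => [|k u v hu hv|j hj].
- by rewrite !linear0 brC br0l linear0 oppr0.
- by rewrite (linearP ((w - _) _)) /= hu hv brDr linearP opprD scalerN.
by rewrite add_lfunE add_lfunE !opp_lfunE sum_c hX // addrAC subrr add0r oppr_pchar2.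
Qed.

(** * Evaluation of Lie terms by parities of multiplicities *)

Definition esum (A : seq nat) : g := \sum_(i <- A) e i.

Lemma esum1 i : esum [:: i] = e i.
Proof. exact: big_seq1. Qed.

Lemma esum0 : esum [::] = 0.
Proof. exact: big_nil. Qed.

Lemma esum_cat A B : esum (A ++ B) = esum A + esum B.
Proof. exact: big_cat. Qed.

Lemma crd_esum A k : lt14 A -> crd (esum A) k = (count_mem k A)%:R.
Proof.
rewrite /esum; elim: A => [|i A IHA] /=; first by rewrite big_nil crd0.
by case/andP=> hi hA; rewrite big_cons crdD crd_e // IHA // natrD eq_sym.
Qed.

Lemma esum_even A : lt14 A -> even_mults A -> esum A = 0.
Proof.
move=> hA /allP hev; apply: eq_crd => k _; rewrite crd0 crd_esum //.
have [/hev/even_halfK<-|/count_memPn-> //] := boolP (k \in A).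
by rewrite -addnn natrD addrr_pchar2.
Qed.

Lemma esum_eq A B : lt14 A -> lt14 B -> even_mults (A ++ B) -> esum A = esum B.
Proof.
move=> hA hB /esum_even; rewrite all_cat hA hB esum_cat => /(_ isT) h.
apply: eq_crd => k _; have := congr1 (crd^~ k) h; rewrite crdD crd0 => /eqP.
by rewrite addr_eq0 oppr_pchar2 // => /eqP.
Qed.

Lemma br_e i j : (i < 14)%N -> (j < 14)%N -> br (e i) (e j) = esum (prods i j).
Proof.
move=> hi hj; apply: eq_crd => k hk; rewrite crd_br_e // crd_esum ?prods_lt //.
rewrite count_uniq_mem ?filter_uniq ?iota_uniq // mem_filter mem_iota.
by rewrite leq0n add0n hk !andbT.
Qed.

Lemma br_esum A B : lt14 A -> lt14 B -> br (esum A) (esum B) = esum (prodl A B).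
Proof.
rewrite /esum /prodl => + hB; elim: A => [|i A IHA] /=; first by rewrite !big_nil br0l.
case/andP=> hi hA; rewrite flatten_cat big_cat !big_cons -IHA //=.
rewrite -[e i]scale1r brDl !scale1r; congr (_ + _) => {IHA}.
elim: B hB => [|j B IHB] /=; first by rewrite !big_nil brC br0l.
case/andP=> hj hB; rewrite big_cat !big_cons -IHB //= -[e j]scale1r brDr !scale1r.
by congr (_ + _); rewrite br_e.
Qed.

Lemma jacobi x y z : br x (br y z) + br y (br z x) + br z (br x y) = 0.
Proof.
pose E x y z := br x (br y z) + br y (br z x) + br z (br x y).
have Ecyc a b c : E a b c = E b c a by rewrite /E [RHS]addrC addrA.
have E_ind (P : g -> g -> Prop) : (forall i y z, (i < 14)%N -> P y z -> E (e i) y z = 0) ->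
    forall x y z, P y z -> E x y z = 0.
  move=> hP {}x {}y {}z hyz; move: x; apply: ind_e => [|k u v hu hv|i hi].
  - by rewrite /E !(br0l, br0r) !addr0.
  - transitivity (k *: E u y z + E v y z); last by rewrite hu hv scaler0 addr0.
    rewrite /E.
    rewrite (brDr _ _ _ z) !(brDl k u v) !brDr !scalerDr.
    by rewrite [RHS]addrACA; congr (_ + _); rewrite addrACA.
  - exact: hP.
apply: (E_ind (fun _ _ => True)) => // i {}y {}z hi _; rewrite Ecyc.
apply: (E_ind (fun _ x => x = e i)) => // j {}z _ hj ->; rewrite Ecyc.
apply: (E_ind (fun x y => x = e i /\ y = e j)) => // k _ _ hk [-> ->]; rewrite Ecyc /E.
have L1 m : (m < 14)%N -> lt14 [:: m] by move=> /= ->.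
have key A B C : lt14 A -> lt14 B -> lt14 C ->
    (let P := table_prodl prod_table in
     even_mults (P A (P B C) ++ P B (P C A) ++ P C (P A B))) ->
    E (esum A) (esum B) (esum C) = 0.
  move=> hA hB hC; rewrite /= !table_prodlE ?prodl_lt // => /esum_even.
  by rewrite !all_cat !prodl_lt !esum_cat addrA -!br_esum ?prodl_lt // => /(_ isT).
have := key _ _ _ (L1 i hi) (L1 j hj) (L1 k hk) (allP jacobi_even _ (triple_mem hi hj hk)).
by rewrite !esum1.
Qed.

Lemma presentation_e (I : Type) (x : I -> g) (R : seq (lie_term K I * lie_term K I))
    (b : seq (lie_term K I)) (p : seq nat) :
  (forall u, br u u = 0) ->
  (forall s t, List.In (s, t) R -> lie_eval br x s = lie_eval br x t) ->
  (forall i, inspan R b (LGen i)) ->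
  (forall i t, List.In t b -> inspan R b (LBr (LGen i) t)) ->
  size b = size p -> uniq p -> lt14 p ->
  (forall i, (i < size p)%N -> lie_eval br x (nth LZero b i) = e (nth 0%N p i)) ->
  defining_relations br x R.
Proof.
move=> brxx hR hgen hbr hsize up /allP hp heval.
apply: (@presentation _ _ R charK _ br x brDl brC brxx jacobi b) => //.
rewrite hsize => c hc i hi.
have hpi : (nth 0%N p i < 14)%N by apply/hp/mem_nth.
have := congr1 (crd^~ (nth 0%N p i)) hc; rewrite crd_sum crd0 (bigD1 (Ordinal hi)) //=.
rewrite heval // crdZ crd_e // eqxx mulr1 big1 ?addr0 // => j ji.
rewrite heval // crdZ crd_e ?(hp _ (mem_nth _ _)) // nth_uniq // eq_sym.
by rewrite (_ : (j == i :> nat) = false) ?mulr0 //; exact: negbTE.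
Qed.

Lemma lie_eval_mults (I : Type) (f : I -> nat) t A : mults f t = Some A ->
  lt14 A /\ lie_eval br (e \o f) t = esum A.
Proof.
elim: t A => [i||s IHs t IHt|//|s IHs t IHt] A /=.
- by case: ifP => // hi [<-]; rewrite /= hi esum1.
- by case=> <-; rewrite esum0.
- case: (mults f s) IHs => // B /(_ _ erefl)[hB ->].
  case: (mults f t) IHt => // C /(_ _ erefl)[hC ->] [<-].
  by rewrite all_cat hB hC esum_cat.
- case: (mults f s) IHs => // B /(_ _ erefl)[hB ->].
  case: (mults f t) IHt => // C /(_ _ erefl)[hC ->] [<-].
  by rewrite prodl_lt br_esum.
Qed.

Lemma lie_eval_eq (I : Type) (f : I -> nat) s t : eq_mults f (s, t) ->
  lie_eval br (e \o f) s = lie_eval br (e \o f) t.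
Proof.
rewrite /eq_mults /=.
case hs: (mults f s) => [A|//]; case ht: (mults f t) => [B|//] hAB.
have [hA ->] := lie_eval_mults hs; have [hB ->] := lie_eval_mults ht.
exact: esum_eq.
Qed.

Lemma lie_eval_rels (I : Type) (f : I -> nat) R : all (eq_mults f) R ->
  forall s t, List.In (s, t) R -> lie_eval br (e \o f) s = lie_eval br (e \o f) t.
Proof.
elim: R => //= p R IHR /andP[hp hR] s t [def_p|/IHR]; last exact.
by apply: lie_eval_eq; rewrite -def_p.
Qed.

Lemma br_table :
  let h1 := br (e 5) (e 2) in let h2 := br (e 10) (e 11) in
  [/\ br h1 (e 5) = 0, br h1 (e 2) = 0, br h1 (e 10) = e 10 & br h1 (e 11) = e 11] /\
  [/\ br h2 (e 5) = e 5, br h2 (e 2) = e 2, br h2 (e 10) = 0 & br h2 (e 11) = 0] /\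
  [/\ br h1 h2 = 0, br (e 2) (e 11) = e 12, br (e 5) (e 10) = e 9,
      br (e 5) (e 11) = 0 & br (e 2) (e 10) = 0].
Proof.
(* With generators indexed by [nat] and [f := id], each entry of the table is a closed Boolean test
   on terms. *)
pose G i := @LGen K nat i; pose h1 := LBr (G 5) (G 2); pose h2 := LBr (G 10) (G 11).
pose z := @LZero K nat; have E s t := lie_eval_eq (f := id) (s := s) (t := t).
split; [|split]; split.
- exact: (E (LBr h1 (G 5)) z).
- exact: (E (LBr h1 (G 2)) z).
- exact: (E (LBr h1 (G 10)) (G 10)).
- exact: (E (LBr h1 (G 11)) (G 11)).
- exact: (E (LBr h2 (G 5)) (G 5)).
- exact: (E (LBr h2 (G 2)) (G 2)).
- exact: (E (LBr h2 (G 10)) z).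
- exact: (E (LBr h2 (G 11)) z).
- exact: (E (LBr h1 h2) z).
- exact: (E (LBr (G 2) (G 11)) (G 12)).
- exact: (E (LBr (G 5) (G 10)) (G 9)).
- exact: (E (LBr (G 5) (G 11)) z).
- exact: (E (LBr (G 2) (G 10)) z).
Qed.

Hypothesis brxx : forall x, br x x = 0.

Lemma presentation_f (I : Type) (f : I -> nat) (R : seq (lie_term K I * lie_term K I))
    (b : seq (lie_term K I)) (p : seq nat) :
  all (eq_mults f) R ->
  (forall i, inspan R b (LGen i)) ->
  (forall i t, List.In t b -> inspan R b (LBr (LGen i) t)) ->
  size b = size p -> uniq p -> lt14 p ->
  all (fun i => if mults f (nth LZero b i) is Some A
    then even_mults (nth 0%N p i :: A) else false) (iota 0 (size p)) ->
  defining_relations br (e \o f) R.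
Proof.
move=> hR hgen hbr hsize up hp hb.
apply: (presentation_e (b := b) (p := p)) => // [|i hi]; first exact: lie_eval_rels.
have := allP hb i; rewrite mem_iota => /(_ hi).
case hA: (mults _ _) => [A|//]; have [lA ->] := lie_eval_mults hA => hev.
have hpi : (nth 0%N p i < 14)%N by apply/(allP hp)/mem_nth.
rewrite -esum1; apply/esym/esum_eq => //; by rewrite /= hpi.
Qed.

Definition pos_index (i : simple_root) : nat := if i is alpha1 then 5 else 10.
Definition neg_index (i : simple_root) : nat := if i is alpha1 then 2 else 11.
Definition all_index (i : chevalley_gen) : nat :=
  match i with GX1p => 5 | GX1m => 2 | GX2p => 10 | GX2m => 11 end.

Lemma pos_presentation : defining_relations br (e \o pos_index) (rels_pos K).
Proof.
have rel s t := eqv_rel (R := rels_pos K) (s := s) (t := t).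
pose b : seq (lie_term K simple_root) := pos_basis (LGen alpha1) (LGen alpha2).
have mem s : List.In s b -> inspan (rels_pos K) b s by exact: inspan_mem.
apply: (@presentation_f _ _ _ b [:: 5; 10; 9]%N) => // [i|i t ht].
- by apply: mem; case: i; rewrite /=; tauto.
have [] := @pos_closed _ _ (rels_pos K) charK (LGen alpha1) (LGen alpha2) b _ _ mem _ ht.
- by apply: rel; left.
- by apply: rel; right; left.
- by case: i.
Qed.

Lemma neg_presentation : defining_relations br (e \o neg_index) (rels_neg K).
Proof.
have rel s t := eqv_rel (R := rels_neg K) (s := s) (t := t).
pose b : seq (lie_term K simple_root) := neg_basis (LGen alpha1) (LGen alpha2).
have mem s : List.In s b -> inspan (rels_neg K) b s by exact: inspan_mem.
apply: (@presentation_f _ _ _ b [:: 2; 11; 12; 8; 4; 0]%N) => // [i|i t ht].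
- by apply: mem; case: i; rewrite /=; tauto.
have [] := @neg_closed _ _ (rels_neg K) charK (LGen alpha1) (LGen alpha2) b
  _ _ _ _ mem _ ht.
- by apply: rel; left.
- by apply: rel; right; left.
- by apply: rel; right; right; left.
- by apply: rel; right; right; right; left.
- by case: i.
Qed.

Lemma all_presentation : defining_relations br (e \o all_index) (rels_all K).
Proof.
pose b : seq (lie_term K chevalley_gen) :=
  all_basis (LGen GX1p) (LGen GX1m) (LGen GX2p) (LGen GX2m).
have mem s : List.In s b -> inspan (rels_all K) b s by exact: inspan_mem.
(* The 11 indices leave out 3, 7 and 13: u_1u_2∂_1, u_1u_2∂_2 and u_1u_2 are not generated by the
   X_i^±. *)
apply: (@presentation_f _ _ _ b [:: 1; 6; 5; 10; 9; 2; 11; 12; 8; 4; 0]%N) => // [i|i t ht].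
- by apply: mem; case: i; rewrite /=; tauto.
have [] := @all_closed _ _ (rels_all K) charK _ _ _ _ (eqv_rel (R := rels_all K)) _ ht.
by case: i.
Qed.

(** * Degrees of the listed derivations and cocycles *)

Variable wt : nat -> int.
Definition homogeneous x (k : int) := forall i, (i < 14)%N -> crd x i != 0 -> k = wt i.

Lemma der_map_homogeneous l d x k : cells14 l -> all (fun p => wt p.1 == wt p.2 + d) l ->
  homogeneous x k -> homogeneous (der_map l x) (k + d).
Proof.
move=> hl /allP hd hx i hi; rewrite crd_der_map // => /eqP h.
suff /hasP[p pl /andP[/eqP <- hp]] : has (fun p => (p.1 == i) && (crd x p.2 != 0)) l.
  have /andP[_ h2] := allP hl _ pl.
  by rewrite (eqP (hd _ pl)) (hx p.2).
apply: contra_notT h => /hasPn h; rewrite big_seq_cond big1 // => p /andP[pl pi].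
by have := h _ pl; rewrite pi /= negbK => /eqP.
Qed.

Lemma coc_map_homogeneous l d x y j k : cells14 l ->
  all (fun p => wt p.1 + wt p.2 + d == 0) l ->
  homogeneous x j -> homogeneous y k -> coc_map l x y != 0 -> j + k + d = 0.
Proof.
move=> hl /allP hd hx hy; rewrite coc_mapE // => /eqP h.
suff /hasP[p pl /andP[h1 h2]] :
    has (fun p => (crd x p.1 != 0) && (crd y p.2 != 0)) (sym_cells l).
  move: pl; rewrite mem_cat => /orP[pl|/mapP[q ql pq]].
    have /andP[l1 l2] := allP hl _ pl.
    by rewrite (hx _ l1 h1) (hy _ l2 h2) (eqP (hd _ pl)).
  move: h1 h2; rewrite {}pq /= => h1 h2; have /andP[l1 l2] := allP hl _ ql.
  by rewrite (hx _ l2 h1) (hy _ l1 h2) [wt _ + _]addrC (eqP (hd _ ql)).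
apply: contra_notT h => /hasPn h; rewrite big_seq big1 // => p pl.
by have := h _ pl; rewrite negb_and !negbK => /orP[]/eqP->; rewrite ?mul0r ?mulr0.
Qed.

End StructureConstants.

(** * Coordinates on L and on gs(2) *)

Lemma span_ind (F : fieldType) (vT : vectType F) (b : seq vT) (P : vT -> Prop) :
  P 0 -> (forall k x y, P x -> P y -> P (k *: x + y)) ->
  (forall v, v \in b -> P v) -> forall x, x \in <<b>>%VS -> P x.
Proof.
move=> P0 PD Pb x; rewrite -[b]/(val (in_tuple b)) => /coord_span->.
apply: big_ind => // [u v Pu Pv | i _]; first by rewrite -[u]scale1r; exact: PD.
by rewrite -[_ *: _]addr0; apply: PD => //; apply/Pb/mem_nth.
Qed.

Section ShortSums.
Variables (V : zmodType) (T : Type) (F : T -> V).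

Lemma sum_seq2 a b : \sum_(p <- [:: a; b]) F p = F a + F b.
Proof. by rewrite !big_cons big_nil addr0. Qed.
Lemma sum_seq4 a b c d : \sum_(p <- [:: a; b; c; d]) F p = F a + F b + F c + F d.
Proof. by rewrite !big_cons big_nil addr0 !addrA. Qed.
Lemma sum_seq5 a b c d f :
  \sum_(p <- [:: a; b; c; d; f]) F p = F a + F b + F c + F d + F f.
Proof. by rewrite !big_cons big_nil addr0 !addrA. Qed.

End ShortSums.

Section Coordinates.
Variable K : fieldType.
Local Notation r00 := (false, false).
Local Notation r10 := (true, false).
Local Notation r01 := (false, true).
Local Notation r11 := (true, true).

(* The coordinates of gs(2), in the order of gs_basis, come first. *)
Definition coords (x : L K) : seq K :=
  let a := (vpart x).1 in let b := (vpart x).2 in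
  let f := volpart x in let g := fpart x in
  [:: a r00; a r10; a r01; a r11; b r00; b r10; b r01; b r11;
      f r00; f r10; f r01; g r10; g r01; g r11; f r11; g r00].

Definition coordL (x : L K) (i : nat) : K := nth 0 (coords x) i.

Lemma coordLP k x y i : coordL (k *: x + y) i = k * coordL x i + coordL y i.
Proof.
rewrite /coordL; do 16?[case: i => [|i] /=]; rewrite ?ffunE //.
by rewrite nth_nil mulr0 addr0.
Qed.

Lemma eq_coordL (x y : L K) :
  (forall i, (i < 16)%N -> coordL x i = coordL y i) -> x = y.
Proof.
case: x y => [[[a b] f] g] [[[a' b'] f'] g'] h.
have H i : coordL (a, b, f, g) i = coordL (a', b', f', g') i.
  have [/h//|] := ltnP i 16; by move=> Hi; rewrite /coordL !nth_default.
congr (_, _, _, _); apply/ffunP => -[[] []].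
- exact: (H 3%N).
- exact: (H 1%N).
- exact: (H 2%N).
- exact: (H 0%N).
- exact: (H 7%N).
- exact: (H 5%N).
- exact: (H 6%N).
- exact: (H 4%N).
- exact: (H 14%N).
- exact: (H 9%N).
- exact: (H 10%N).
- exact: (H 8%N).
- exact: (H 13%N).
- exact: (H 11%N).
- exact: (H 12%N).
- exact: (H 15%N).
Qed.

Lemma sum_mon (F : mon -> K) :
  \sum_r F r = F r11 + F r10 + (F r01 + F r00).
Proof.
rewrite (eq_bigr (fun p => F (p.1, p.2))) => [|[] //].
by rewrite -(pair_big xpredT xpredT (fun a b => F (a, b))) /= !big_bool.
Qed.

Lemma mulOE (f g : Oalg K) r :
  mulO f g r = match r with
    | r00 => f r00 * g r00
    | r10 => f r10 * g r00 + f r00 * g r10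
    | r01 => f r01 * g r00 + f r00 * g r01
    | r11 => f r11 * g r00 + f r10 * g r01 + f r01 * g r10 + f r00 * g r11
    end.
Proof.
rewrite ffunE; under eq_bigr do rewrite big_mkcond sum_mon.
by rewrite sum_mon; case: r => [[] []]; rewrite /= ?(addr0, add0r) ?addrA.
Qed.

Lemma mulO00 (f g : Oalg K) : mulO f g r00 = f r00 * g r00.
Proof. exact: mulOE. Qed.
Lemma mulO10 (f g : Oalg K) : mulO f g r10 = f r10 * g r00 + f r00 * g r10.
Proof. exact: mulOE. Qed.
Lemma mulO01 (f g : Oalg K) : mulO f g r01 = f r01 * g r00 + f r00 * g r01.
Proof. exact: mulOE. Qed.
Lemma mulO11 (f g : Oalg K) : mulO f g r11 =
  f r11 * g r00 + f r10 * g r01 + f r01 * g r10 + f r00 * g r11.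
Proof. exact: mulOE. Qed.
Lemma addOE (f g : Oalg K) r : (f + g) r = f r + g r.
Proof. by rewrite ffunE. Qed.
Lemma oppOE (f : Oalg K) r : (- f) r = - f r.
Proof. by rewrite ffunE. Qed.
Lemma dO1E (f : Oalg K) (b : bool) :
  (dO1 f (true, b) = 0) * (dO1 f (false, b) = f (true, b)).
Proof. by rewrite !ffunE. Qed.
Lemma dO2E (f : Oalg K) (b : bool) :
  (dO2 f (b, true) = 0) * (dO2 f (b, false) = f (b, true)).
Proof. by rewrite !ffunE. Qed.
Definition OE := (addOE, oppOE, dO1E, dO2E, mulO00, mulO10, mulO01, mulO11).

Lemma coordL_modc (x : L K) k :
  coordL (modc x) k = if k == 15%N then 0 else coordL x k.
Proof.
by rewrite /coordL; do 16?[case: k => [|k] /=]; rewrite ?ffunE ?nth_nil.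
Qed.

Hypothesis charK : 2%N \in [pchar K].

(** The link between the definition of the bracket and the table. Index 14 occurs among the
    arguments since u_1u_2v lies in L; index 15 does not, as constants have zero derivatives and are
    removed from the values. *)
Lemma coordL_br (x y : L K) k : coordL (br_me x y) k =
  \sum_(t <- structure_constants | t.2 == k)
     (coordL x t.1.1 * coordL y t.1.2 + coordL x t.1.2 * coordL y t.1.1).
Proof.
have two0 : 2%:R = 0 :> K by exact: pcharf0.
have N2 (z : K) : - z = z by exact: oppr_pchar2.
rewrite coordL_modc; case: x y => [[[a b] f] g] [[[a' b'] f'] g'].
rewrite unlock /structure_constants /coordL.
do 16?[case: k => [|k]; first by
  rewrite [LHS]/= [RHS]/= /volpart /= /actO /actVol /divO /= ?OE ?N2; ring: two0].
by case: k.
Qed.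

Lemma br_meDl k (x y z : L K) : br_me (k *: x + y) z = k *: br_me x z + br_me y z.
Proof.
apply: eq_coordL => i _; rewrite coordLP !coordL_br mulr_sumr -big_split.
by apply: eq_bigr => t _ /=; rewrite !coordLP; ring.
Qed.

Lemma br_meDr k (x y z : L K) : br_me z (k *: x + y) = k *: br_me z x + br_me z y.
Proof.
apply: eq_coordL => i _; rewrite coordLP !coordL_br mulr_sumr -big_split.
by apply: eq_bigr => t _ /=; rewrite !coordLP; ring.
Qed.

(** D(f) + f div D and H_f(g) are divergences in characteristic 2, so they have no u_1u_2 term; in
    the table, no triple ends in 14. *)
Lemma coordL_br0 (x y : L K) k : (14 <= k)%N -> coordL (br_me x y) k = 0.
Proof.
move=> hk; rewrite coordL_br big_seq_cond big1 // => t /andP[ht /eqP tk].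
have : all (fun t => t.2 < 14)%N structure_constants by [].
by move=> /allP/(_ _ ht); rewrite tk ltnNge hk.
Qed.

Lemma br_me_gs2 (x y : L K) : br_me x y \in gs2 K.
Proof.
have me_modc (z : L K) : modc z \in me K by rewrite -[modc z]lfunE memv_img ?memvf.
(* [gs2] is spanned by brackets of elements of [me], so constants are first removed from the
   arguments, without changing the bracket. *)
have br_modc : br_me x y = br_me (modc x) (modc y).
  apply: eq_coordL => i _; rewrite !coordL_br big_seq_cond [RHS]big_seq_cond.
  apply: eq_bigr => t /andP[+ _].
  have modcE (z : L K) j : (j < 15)%N -> coordL (modc z) j = coordL z j.
    by do 15?[case: j => [|j] //=]; rewrite /coordL /= ffunE.
  have /allP h : all (fun t => (t.1.1 < 15) && (t.1.2 < 15))%N structure_constants by [].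
  by move=> /h/andP[h1 h2]; rewrite !modcE.
have br0l (z : L K) : br_me 0 z = 0.
  by have := br_meDl (-1) 0 0 z; rewrite !scaleN1r oppr0 addr0 addNr.
have br0r (z : L K) : br_me z 0 = 0.
  by have := br_meDr (-1) 0 0 z; rewrite !scaleN1r oppr0 addr0 addNr.
have spanP (z : L K) : z \in me K -> z \in <<vbasis (me K)>>%VS.
  by rewrite (span_basis (vbasisP _)).
rewrite br_modc; move: (me_modc x) (me_modc y) => /spanP mx /spanP.
move: (modc y); apply: span_ind => [|k u v mu mv|u mu].
- by rewrite br0r mem0v.
- by rewrite br_meDr memvD ?memvZ.
move: (modc x) mx; apply: span_ind => [|k v w mv mw|v mv].
- by rewrite br0l mem0v.
- by rewrite br_meDl memvD ?memvZ.
by apply: memv_span; apply/allpairsP; exists (v, u).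
Qed.

Lemma gs2_coordL (x : L K) k : x \in gs2 K -> (14 <= k)%N -> coordL x k = 0.
Proof.
move=> + hk; move: x; apply: span_ind => [|a u v hu hv|_ /allpairsP[[u v] /= [_ _ ->]]].
- by have := coordLP (-1) 0 0 k; rewrite scaleN1r oppr0 addr0 mulN1r addNr.
- by rewrite coordLP hu hv mulr0 addr0.
- exact: coordL_br0.
Qed.

Definition monoL (a : nat) : L K :=
  let m1 := mono K r00 in let mu1 := mono K r10 in
  let mu2 := mono K r01 in let mu12 := mono K r11 in
  nth 0 [:: mkL (m1, 0) 0 0; mkL (mu1, 0) 0 0; mkL (mu2, 0) 0 0;
            mkL (mu12, 0) 0 0; mkL (0, m1) 0 0; mkL (0, mu1) 0 0;
            mkL (0, mu2) 0 0; mkL (0, mu12) 0 0; mkL 0 m1 0; mkL 0 mu1 0;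
            mkL 0 mu2 0; mkL 0 0 mu1; mkL 0 0 mu2; mkL 0 0 mu12] a.

Lemma coordL_mono a i : (a < 14)%N -> coordL (monoL a) i = (i == a)%:R.
Proof.
by do 14?[case: a => [_|a //]; first by
  do 16?[case: i => [|i] /=]; rewrite /coordL /= ?ffunE ?nth_nil].
Qed.

Lemma coordL_br_mono a b k : (a < 14)%N -> (b < 14)%N ->
  coordL (br_me (monoL a) (monoL b)) k = (br_coef a b k)%:R.
Proof.
move=> ha hb; rewrite coordL_br /br_coef.
elim: structure_constants => [|t s IHs] /=; rewrite !(big_nil, big_cons) //.
by rewrite !coordL_mono //; case: ifP => _; rewrite ?(natr_addb _ _ charK) ?natr_andb IHs.
Qed.

(* The entry a of s is a pair of indices of monomials whose bracket is monoL a. *)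
Lemma monoL_gs2 a : (a < 14)%N -> monoL a \in gs2 K.
Proof.
pose s := [:: (0,1); (3,4); (1,2); (3,6); (4,6); (5,6); (0,7); (1,7);
              (0,9); (6,9); (1,10); (1,11); (6,12); (6,13)]%N.
have /allP h : all (fun a => let p := nth (0, 0)%N s a in
    [&& p.1 < 14, p.2 < 14 &
     all (fun i => br_coef p.1 p.2 i == (i == a)) (iota 0 16)]%N) (iota 0 14).
  by vm_compute.
move=> ha; have := h a; rewrite mem_iota => /(_ ha) /and3P[h1 h2 /allP h3].
suff -> : monoL a = br_me (monoL (nth (0, 0)%N s a).1) (monoL (nth (0, 0)%N s a).2).
  exact: br_me_gs2.
apply: eq_coordL => i hi; rewrite coordL_br_mono // coordL_mono //.
by have := h3 i; rewrite mem_iota => /(_ hi) /eqP->.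
Qed.

(** * The Lie algebra gs(2) in coordinates *)

Implicit Types x y : gs K.

Definition gs_crd x (i : nat) : K := coordL (vsval x) i.
Definition gs_e (i : nat) : gs K := nth 0 (gs_basis K) i.

Lemma gs_crdP k x y i : gs_crd (k *: x + y) i = k * gs_crd x i + gs_crd y i.
Proof. exact: coordLP. Qed.

Lemma eq_gs_crd x y : (forall i, (i < 14)%N -> gs_crd x i = gs_crd y i) -> x = y.
Proof.
move=> h; apply/val_inj/eq_coordL => i _; have [/h//|hi] := ltnP i 14.
by rewrite !gs2_coordL // subvsP.
Qed.

Lemma vsval_gs_e i : (i < 14)%N -> vsval (gs_e i) = monoL i.
Proof.
move=> hi; have -> : gs_e i = vsproj (gs2 K) (monoL i).
  by do 14?[case: i hi => [//|i hi]].
by rewrite vsprojK // monoL_gs2.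
Qed.

Lemma gs_crd_e a i : (a < 14)%N -> gs_crd (gs_e a) i = (i == a)%:R.
Proof. by move=> ha; rewrite /gs_crd vsval_gs_e // coordL_mono. Qed.

Lemma gs_crd_br x y k : gs_crd (br x y) k = coordL (br_me (vsval x) (vsval y)) k.
Proof. by rewrite /gs_crd /br vsprojK // br_me_gs2. Qed.

Lemma gs_brDl k x y z : br (k *: x + y) z = k *: br x z + br y z.
Proof.
by apply: eq_gs_crd => i _; rewrite gs_crdP !gs_crd_br br_meDl coordLP.
Qed.

Lemma gs_brxx x : br x x = 0.
Proof.
apply: eq_gs_crd => i _; rewrite gs_crd_br coordL_br (crd0 gs_crdP) big1 // => t _.
by rewrite mulrC addrr_pchar2.
Qed.

Lemma gs_brC x y : br x y = br y x.
Proof.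
apply: eq_gs_crd => i _; rewrite gs_crd_br (gs_crd_br y) !coordL_br.
by apply: eq_bigr => t _; rewrite addrC mulrC [X in _ + X]mulrC.
Qed.

Lemma gs_crd_br_e i j k : (i < 14)%N -> (j < 14)%N ->
  gs_crd (br (gs_e i) (gs_e j)) k = (br_coef i j k)%:R.
Proof.
by move=> hi hj; rewrite gs_crd_br !vsval_gs_e // coordL_br_mono.
Qed.

Lemma sum_gs_crd x : x = \sum_(i < 14) gs_crd x i *: gs_e i.
Proof.
apply: eq_gs_crd => k hk; rewrite (crd_sum gs_crdP) (bigD1 (Ordinal hk)) //=.
rewrite (crdZ gs_crdP) gs_crd_e // eqxx mulr1 big1 ?addr0 // => i ik.
rewrite (crdZ gs_crdP) gs_crd_e // eq_sym (_ : (i == k :> nat) = false) ?mulr0 //.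
exact: negbTE.
Qed.

Lemma gs_basis_free : free (gs_basis K).
Proof.
apply/freeP => k h i.
have : gs_crd (\sum_(j < 14) k j *: (gs_basis K)`_j) i = 0.
  by rewrite h (crd0 gs_crdP).
rewrite (crd_sum gs_crdP) (bigD1 i) //= (crdZ gs_crdP) -/(gs_e i) gs_crd_e //.
rewrite eqxx mulr1 big1 ?addr0 // => j ij; rewrite (crdZ gs_crdP) -/(gs_e j).
rewrite gs_crd_e // eq_sym (_ : (j == i :> nat) = false) ?mulr0 //.
exact: negbTE.
Qed.

Definition gs_hat (b : nat) : 'Hom(gs K, K^o) := hat (gs_e b).

(** [hat] finds its vector through [index], which gives back the position [b] because a free family
    has no repetition. *)
Lemma gs_hatE b x : (b < 14)%N -> gs_hat b x = gs_crd x b.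
Proof.
move=> hb; have -> : gs_hat b x =
    coord (gs_basis K) (inord (index (gs_e b) (gs_basis K))) x.
  by rewrite /gs_hat /hat lfunE.
rewrite index_uniq ?size_tuple ?free_uniq ?gs_basis_free //.
by rewrite {1}[x]sum_gs_crd coord_sum_free ?gs_basis_free // inordK.
Qed.

Definition weight (i : nat) : int :=
  nth 0 [:: -3; 0; 0; 3; -3; 0; 0; 3; -2; 1; 1; -1; -1; 2] i.

Lemma degreeP x k : degree (vsval x) k <-> homogeneous gs_crd weight x k.
Proof.
(* [degree] also constrains the coefficients of u_1u_2v and 1, which vanish on gs(2). *)
have z14 : volpart (vsval x) (true, true) = 0.
  exact: (@gs2_coordL (vsval x) 14 (subvsP x)).
have z15 : fpart (vsval x) (false, false) = 0.
  exact: (@gs2_coordL (vsval x) 15 (subvsP x)).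
split=> [h i|h r].
  have h00 : [/\ _, _ & _] := h (false, false); have h10 : [/\ _, _ & _] := h (true, false).
  have h01 : [/\ _, _ & _] := h (false, true); have h11 : [/\ _, _ & _] := h (true, true).
  rewrite /gs_crd /coordL /coords; do 14?[case: i => [|i] //]; move=> _ /= hx.
  - by have [h1 _ _] := h00; exact: (h1 (or_introl hx)).
  - by have [h1 _ _] := h10; exact: (h1 (or_introl hx)).
  - by have [h1 _ _] := h01; exact: (h1 (or_introl hx)).
  - by have [h1 _ _] := h11; exact: (h1 (or_introl hx)).
  - by have [h1 _ _] := h00; exact: (h1 (or_intror hx)).
  - by have [h1 _ _] := h10; exact: (h1 (or_intror hx)).
  - by have [h1 _ _] := h01; exact: (h1 (or_intror hx)).
  - by have [h1 _ _] := h11; exact: (h1 (or_intror hx)).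
  - by have [_ h2 _] := h00; exact: (h2 hx).
  - by have [_ h2 _] := h10; exact: (h2 hx).
  - by have [_ h2 _] := h01; exact: (h2 hx).
  - by have [_ _ h3] := h10; exact: (h3 hx).
  - by have [_ _ h3] := h01; exact: (h3 hx).
  - by have [_ _ h3] := h11; exact: (h3 hx).
have h' i : (i < 14)%N -> gs_crd x i != 0 -> k = weight i by exact: h.
move: h' => {}h; case: r => [[] []] n; split.
- by case=> [/(h 3%N isT)|/(h 7%N isT)].
- by rewrite z14 eqxx.
- exact: (h 13%N isT).
- by case=> [/(h 1%N isT)|/(h 5%N isT)].
- exact: (h 9%N isT).
- exact: (h 11%N isT).
- by case=> [/(h 2%N isT)|/(h 6%N isT)].
- exact: (h 10%N isT).
- exact: (h 12%N isT).
- by case=> [/(h 0%N isT)|/(h 4%N isT)].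
- exact: (h 8%N isT).
- by rewrite z15 eqxx.
Qed.

Local Notation gs_der := (der_map gs_e gs_hat).
Local Notation gs_coc := (coc_map gs_hat).

Lemma der_m4E : der_m4 K = gs_der [:: (0, 10); (4, 9); (8, 13); (11, 7); (12, 3)]%N.
Proof. by rewrite /der_map sum_seq5. Qed.

Lemma der_m2_1E : der_m2_1 K = gs_der [:: (4, 12); (8, 2); (9, 3); (5, 13)]%N.
Proof. by rewrite /der_map sum_seq4. Qed.

Lemma der_m2_2E : der_m2_2 K = gs_der [:: (0, 11); (8, 5); (10, 7); (2, 13)]%N.
Proof. by rewrite /der_map sum_seq4. Qed.

Lemma der_2_1E : der_2_1 K = gs_der [:: (12, 4); (10, 11); (2, 8); (13, 5); (3, 9)]%N.
Proof. by rewrite /der_map sum_seq5. Qed.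

Lemma der_2_2E : der_2_2 K = gs_der [:: (11, 0); (9, 12); (5, 8); (13, 2); (7, 10)]%N.
Proof. by rewrite /der_map sum_seq5. Qed.

Lemma der_4E : der_4 K = gs_der [:: (10, 0); (9, 4); (7, 11); (3, 12)]%N.
Proof. by rewrite /der_map sum_seq4. Qed.

Lemma coc_m2_1E : coc_m2_1 K = gs_coc [:: (12, 3); (2, 13)]%N.
Proof. by rewrite /coc_map sum_seq2. Qed.
Lemma coc_m2_2E : coc_m2_2 K = gs_coc [:: (11, 7); (5, 13)]%N.
Proof. by rewrite /coc_map sum_seq2. Qed.
Lemma coc_4E : coc_4 K = gs_coc [:: (0, 11); (4, 12)]%N.
Proof. by rewrite /coc_map sum_seq2. Qed.

Lemma der_tuple (s : 'I_6) :
  tnth [tuple der_m4 K; der_m2_1 K; der_m2_2 K; der_2_1 K; der_2_2 K; der_4 K] s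
  = gs_der (nth [::] der_cells s).
Proof.
case: s => -[|[|[|[|[|[|//]]]]]] hs; rewrite (tnth_nth 0).
- exact: der_m4E.
- exact: der_m2_1E.
- exact: der_m2_2E.
- exact: der_2_1E.
- exact: der_2_2E.
- exact: der_4E.
Qed.

Lemma coc_tuple (s : 'I_3) :
  tnth [tuple coc_m2_1 K; coc_m2_2 K; coc_4 K] s = gs_coc (nth [::] coc_cells s).
Proof.
case: s => -[|[|[|//]]] hs; rewrite (tnth_nth 0).
- exact: coc_m2_1E.
- exact: coc_m2_2E.
- exact: coc_4E.
Qed.

Lemma gs_der_degree l d : cells14 l ->
  all (fun p => weight p.1 == weight p.2 + d) l -> degree_End (gs_der l) d.
Proof.
move=> hl hd x k /degreeP hx; apply/degreeP.
exact: (der_map_homogeneous gs_crdP gs_crd_e gs_hatE hl hd hx).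
Qed.

Lemma gs_coc_degree l d : cells14 l ->
  all (fun p => weight p.1 + weight p.2 + d == 0) l -> degree_form (gs_coc l) d.
Proof.
move=> hl hd x y j k /degreeP hx /degreeP hy.
exact: (coc_map_homogeneous charK gs_hatE hl hd hx hy).
Qed.

End Coordinates.

Theorem lemma5p1 (K : closedFieldType) (charK : 2%N \in [pchar K]) :
  (* 1) multiplication table and defining relations *)
  ([/\ br H1 X1p = 0 :> gs K, br H1 X1m = 0 :> gs K,
       br H1 X2p = X2p :> gs K & br H1 X2m = X2m :> gs K] /\
   [/\ br H2 X1p = X1p :> gs K, br H2 X1m = X1m :> gs K,
       br H2 X2p = 0 :> gs K & br H2 X2m = 0 :> gs K] /\
   [/\ br H1 H2 = 0 :> gs K,
       br X1m X2m = e_u2 :> gs K, br X1p X2p = e_u1v :> gs K,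
       br X1p X2m = 0 :> gs K & br X1m X2p = 0 :> gs K] /\
   [/\ ad 2 X1p X2p = 0 :> gs K & ad 2 X2p X1p = 0 :> gs K] /\
   [/\ ad 4 X2m X1m = 0 :> gs K,
       ad 2 X1m (ad 3 X2m X1m) = 0 :> gs K,
       br X2m (br X1m (ad 3 X2m X1m)) = 0 :> gs K
     & ad 2 X1m X2m = 0 :> gs K] /\
   [/\ defining_relations br (@Xp K) (rels_pos K),
       defining_relations br (@Xm K) (rels_neg K)
     & defining_relations br (@Xall K) (rels_all K)]) /\
  (* 2) outer derivations *)
  (basis_mod (derivation (@br K)) (inner_derivation (@br K))
     [tuple der_m4 K; der_m2_1 K; der_m2_2 K; der_2_1 K; der_2_2 K; der_4 K] /\
   [/\ degree_End (der_m4 K) (- 4), degree_End (der_m2_1 K) (- 2)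
     & degree_End (der_m2_2 K) (- 2)] /\
   [/\ degree_End (der_2_1 K) 2, degree_End (der_2_2 K) 2
     & degree_End (der_4 K) 4]) /\
  (* 3) central extensions *)
  (basis_mod (cocycle2 (@br K)) (coboundary2 (@br K))
     [tuple coc_m2_1 K; coc_m2_2 K; coc_4 K] /\
   [/\ degree_form (coc_m2_1 K) (- 2), degree_form (coc_m2_2 K) (- 2)
     & degree_form (coc_4 K) 4]).
Proof.
have [[t1 t2 t3 t4] [[t5 t6 t7 t8] [t9 t10 t11 t12 t13]]] := br_table charK
  (gs_brDl charK) (gs_brC charK) (@gs_crdP K) (gs_crd_e charK) (sum_gs_crd charK)
  (gs_crd_br_e charK).
have rel := lie_eval_rels charK (gs_brDl charK) (gs_brC charK) (@gs_crdP K)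
  (gs_crd_e charK) (sum_gs_crd charK) (gs_crd_br_e charK).
split; last split.
- split; first exact: And4 t1 t2 t3 t4.
  split; first exact: And4 t5 t6 t7 t8.
  split; first exact: And5 t9 t10 t11 t12 t13.
  (* [isT] has the required type by conversion: the parity test on the relations computes to
     [true]. *)
  have hp := rel _ pos_index (rels_pos K) isT.
  have hn := rel _ neg_index (rels_neg K) isT.
  pose x : lie_term K simple_root := LGen alpha1.
  pose y : lie_term K simple_root := LGen alpha2.
  split.
    split; [exact: (hp (LAd 2 x y) LZero (or_introl erefl))
           |exact: (hp (LAd 2 y x) LZero (or_intror (or_introl erefl)))].
  split.
    split.
    - exact: (hn (LAd 4 y x) LZero (or_introl erefl)).
    - exact: (hn (LAd 2 x (LAd 3 y x)) LZero (or_intror (or_introl erefl))).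
    - exact: (hn (LBr y (LBr x (LAd 3 y x))) LZero
        (or_intror (or_intror (or_introl erefl)))).
    - exact: (hn (LAd 2 x y) LZero
        (or_intror (or_intror (or_intror (or_introl erefl))))).
  split.
  (* [Xp] and [gs_e \o pos_index] agree after a case analysis on the root, hence the passage through
     pointwise equality. *)
  + apply: eq_defining_relations (pos_presentation charK (gs_brDl charK)
      (gs_brC charK) (@gs_crdP K) (gs_crd_e charK) (sum_gs_crd charK)
      (gs_crd_br_e charK) (gs_brxx charK)); by case.
  + apply: eq_defining_relations (neg_presentation charK (gs_brDl charK)
      (gs_brC charK) (@gs_crdP K) (gs_crd_e charK) (sum_gs_crd charK)
      (gs_crd_br_e charK) (gs_brxx charK)); by case.
  + apply: eq_defining_relations (all_presentation charK (gs_brDl charK)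
      (gs_brC charK) (@gs_crdP K) (gs_crd_e charK) (sum_gs_crd charK)
      (gs_crd_br_e charK) (gs_brxx charK)); by case.
- split.
    exact: (der_basis charK (gs_brDl charK) (gs_brC charK) (@gs_crdP K)
      (gs_crd_e charK) (sum_gs_crd charK) (gs_crd_br_e charK) (gs_hatE charK)
      (@der_tuple K)).
  rewrite der_m4E der_m2_1E der_m2_2E der_2_1E der_2_2E der_4E.
  by split; split; apply: gs_der_degree.
- split.
    exact: (coc_basis charK (gs_brDl charK) (gs_brC charK) (gs_crd_e charK)
      (sum_gs_crd charK) (gs_crd_br_e charK) (gs_hatE charK) (@coc_tuple K)).
  rewrite coc_m2_1E coc_m2_2E coc_4E.
  by split; apply: gs_coc_degree.
Qed.
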